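(* Let $\bigl((E_i)_{i\in I},(\varphi_{ji})_{i,j\in I,\,j\geq i}\bigr)$ be a direct system in the category $\mathbf{BL}_{\mathrm{AIPLH}}$ of Banach lattices and contractive almost interval preserving lattice homomorphisms. Then it has a direct limit in $\mathbf{BL}_{\mathrm{AIPLH}}$. Take a direct limit $\bigl(E,(\varphi_i)_{i\in I}\bigr)$ of the system in $\mathbf{BL}_{\mathrm{AIPLH}}$. If all $E_i$ are order continuous, then so is $E$.
   Context: All vector spaces are real. A lattice homomorphism is a vector lattice homomorphism. Contractive means of norm at most $1$. A Banach lattice is called order continuous if its norm is order continuous. A linear map $\varphi\colon E\to F$ from a vector lattice into a normed lattice is almost interval preserving if it is positive and $[0,\varphi(x)]=\overline{\varphi([0,x])}$ (norm closure in $F$) for all $x\in E^+$. Direct systems and limits in a category: let $I$ be a non-empty directed set. A direct system over $I$ consists of objects $O_i$ ($i\in I$) and morphisms $\varphi_{ji}\colon O_i\to O_j$ for $j\geq i$ such that $\varphi_{ii}$ is the identity and $\varphi_{kj}\circ\varphi_{ji}=\varphi_{ki}$ for $i\leq j\leq k$. A system $(O,(\varphi_i))$ of an object $O$ and morphisms $\varphi_i\colon O_i\to O$ is compatible if $\varphi_j\circ\varphi_{ji}=\varphi_i$ for all $j\geq i$. A direct limit is a compatible system $(O,(\varphi_i))$ such that, for every compatible system $(O',(\varphi_i'))$, there is a unique morphism $\chi\colon O\to O'$ with $\varphi_i'=\chi\circ\varphi_i$ for all $i$. *)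

(* Defs.v *)
From HB Require Import structures.
From mathcomp Require Import all_boot all_order all_algebra.
From mathcomp Require Import all_classical all_reals all_analysis.

Set Implicit Arguments.
Unset Strict Implicit.
Unset Printing Implicit Defensive.

Import Order.TTheory GRing.Theory Num.Theory.
Import numFieldNormedType.Exports.

Local Open Scope classical_set_scope.
Local Open Scope ring_scope.

Reserved Notation "x <=v y" (at level 70, no associativity).

(* The order of a vector lattice is introduced here instead of being inherited
   from Order.Lattice because Hierarchy Builder rejects the join of
   Order.Lattice with GRing.Lmodule, and that of Order.POrder with NormedModule:
   Num.RealDomain and Num.NumDomain already inherit from parts of both without a
   common ancestor. *)
HB.mixin Record Lmodule_isVectorLattice (R : numDomainType) V
    of GRing.Lmodule R V := {
  vle : V -> V -> Prop ;
  vjoin : V -> V -> V ;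
  vmeet : V -> V -> V ;
  vle_refl : forall x : V, vle x x ;
  vle_anti : forall x y : V, vle x y -> vle y x -> x = y ;
  vle_trans : forall y x z : V, vle x y -> vle y z -> vle x z ;
  vle_joinl : forall x y : V, vle x (vjoin x y) ;
  vle_joinr : forall x y : V, vle y (vjoin x y) ;
  vjoin_le : forall x y z : V, vle x z -> vle y z -> vle (vjoin x y) z ;
  vmeet_lel : forall x y : V, vle (vmeet x y) x ;
  vmeet_ler : forall x y : V, vle (vmeet x y) y ;
  vle_meet : forall x y z : V, vle z x -> vle z y -> vle z (vmeet x y) ;
  vle_add2r : forall z x y : V, vle x y -> vle (x + z) (y + z) ;
  vscaler_ge0 : forall (a : R) (x : V), 0 <= a -> vle 0 x -> vle 0 (a *: x)
}.

#[short(type="vectorLatticeType")]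
HB.structure Definition VectorLattice (R : numDomainType) :=
  {V of GRing.Lmodule R V & Lmodule_isVectorLattice R V}.

Notation "x <=v y" := (vle x y) : ring_scope.

(* The modulus of x as an element of a vector lattice; the notation `|x| is
   the norm. *)
Definition modulus (R : numDomainType) (V : vectorLatticeType R) (x : V) : V :=
  vjoin x (- x).

HB.mixin Record NormedModule_VectorLattice_isNormedLattice
    (R : numFieldType) V of NormedModule R V & VectorLattice R V := {
  lattice_norm : forall x y : V, modulus x <=v modulus y -> `|x| <= `|y|
}.

#[short(type="normedLatticeType")]
HB.structure Definition NormedLattice (R : numFieldType) :=
  {V of NormedModule R V & VectorLattice R V
      & NormedModule_VectorLattice_isNormedLattice R V}.

#[short(type="banachLatticeType")]
HB.structure Definition BanachLattice (R : numFieldType) :=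
  {V of NormedLattice R V & CompleteNormedModule R V}.

Definition order_interval (R : numDomainType) (V : vectorLatticeType R)
    (x y : V) : set V :=
  [set z | x <=v z /\ z <=v y].

Definition is_infimum (R : numDomainType) (V : vectorLatticeType R)
    (A : set V) (m : V) : Prop :=
  (forall x : V, A x -> m <=v x) /\
  (forall y : V, (forall x : V, A x -> y <=v x) -> y <=v m).

Definition operator_norm (R : realType) (E F : normedModType R) (f : E -> F) :
    \bar R :=
  ereal_sup [set `|f x|%:E | x in [set x : E | `|x| <= 1]].

Definition contractive (R : realType) (E F : normedModType R) (f : E -> F) :
    Prop :=
  (operator_norm f <= 1)%E.

Definition lattice_homomorphism (R : realType) (E F : vectorLatticeType R)
    (f : E -> F) : Prop :=
  [/\ linear f,
      forall x y : E, f (vjoin x y) = vjoin (f x) (f y) &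
      forall x y : E, f (vmeet x y) = vmeet (f x) (f y)].

Definition almost_interval_preserving (R : realType)
    (E : vectorLatticeType R) (F : normedLatticeType R) (f : E -> F) : Prop :=
  [/\ linear f,
      forall x : E, 0 <=v x -> 0 <=v f x &
      forall x : E, 0 <=v x ->
        order_interval 0 (f x) = closure (f @` order_interval 0 x)].

Definition BL_AIPLH_morphism (R : realType) (E F : banachLatticeType R)
    (f : E -> F) : Prop :=
  [/\ contractive f, lattice_homomorphism f & almost_interval_preserving f].

Definition directed (d : Order.disp_t) (I : preorderType d) : Prop :=
  inhabited I /\
  forall i j : I, exists k : I, (i <= k)%O /\ (j <= k)%O.

(* The connecting map usually written phi_{ji}, target index first, is
   [ds_map ij] for [ij : i <= j]. *)
Record direct_system (R : realType) (d : Order.disp_t) (I : preorderType d) :=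
  DirectSystem {
    ds_obj :> I -> banachLatticeType R ;
    ds_map : forall i j : I, (i <= j)%O -> ds_obj i -> ds_obj j ;
    ds_map_morphism : forall (i j : I) (ij : (i <= j)%O),
      BL_AIPLH_morphism (ds_map ij) ;
    ds_map_id : forall (i : I) (ii : (i <= i)%O), ds_map ii = id ;
    ds_map_comp : forall (i j k : I) (ij : (i <= j)%O) (jk : (j <= k)%O)
      (ik : (i <= k)%O), ds_map jk \o ds_map ij = ds_map ik
  }.

Definition compatible_system (R : realType) (d : Order.disp_t)
    (I : preorderType d) (S : direct_system R I) (E : banachLatticeType R)
    (phi : forall i : I, S i -> E) : Prop :=
  (forall i : I, BL_AIPLH_morphism (phi i)) /\
  (forall (i j : I) (ij : (i <= j)%O), phi j \o ds_map ij = phi i).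

Definition direct_limit (R : realType) (d : Order.disp_t)
    (I : preorderType d) (S : direct_system R I) (E : banachLatticeType R)
    (phi : forall i : I, S i -> E) : Prop :=
  compatible_system phi /\
  forall (E' : banachLatticeType R) (phi' : forall i : I, S i -> E'),
    compatible_system phi' ->
    exists! chi : E -> E',
      BL_AIPLH_morphism chi /\ forall i : I, phi' i = chi \o phi i.

Definition order_continuous (R : realType) (E : normedLatticeType R) : Prop :=
  forall (d : Order.disp_t) (J : preorderType d) (x : J -> E),
    directed J ->
    (forall i j : J, (i <= j)%O -> x j <=v x i) ->
    is_infimum (range x) 0 ->
    forall e : R, 0 < e ->
      exists i : J, forall j : J, (i <= j)%O -> `|x j| < e.

(* Main.v *)
(* The limit is built from the nets (x_i) in the product of the E_i that are
   asymptotically coherent: phi_kj x_j - x_k is small in norm for k >= j far out.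
   They form a vector lattice, limsup |x_i| is a lattice seminorm on it, and the
   limit is the quotient by the null nets. It is complete because a fast Cauchy
   sequence phi_(i_n) y_n with (i_n) increasing has as limit any net x such that
   x_j is close to phi_(j i_n) y_n for all n with i_n <= j at once. Every compatible
   system factors through it since its maps are dominated in norm by the canonical
   ones, whose images are dense.

   Density of the images holds in every direct limit E by uniqueness. For order
   continuity of E it then suffices that decreasing positive sequences in E are
   Cauchy. Up to a small error such a sequence lies in some [0, phi_i v], where
   partial meets of almost interval preserving preimages lift it to a decreasing
   sequence in [0, v], which is Cauchy because E_i is order continuous. *)

From HB Require Import structures.
Require Import Defs.
From mathcomp Require Import all_boot all_order all_algebra.
From mathcomp Require Import all_classical all_reals all_analysis.
From mathcomp Require Import ring lra.

Set Implicit Arguments.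
Unset Strict Implicit.
Unset Printing Implicit Defensive.

Import Order.TTheory GRing.Theory Num.Theory.
Import numFieldNormedType.Exports.

Local Open Scope classical_set_scope.
Local Open Scope ring_scope.

(** * Vector lattices *)

Section VectorLatticeTheory.
Variables (R : realType) (V : vectorLatticeType R).
Implicit Types x y z : V.

Lemma vle_add2l z x y : x <=v y -> z + x <=v z + y.
Proof. by rewrite ![z + _]addrC; apply: vle_add2r. Qed.

Lemma vle_add x y z w : x <=v y -> z <=v w -> x + z <=v y + w.
Proof. by move=> xy zw; apply: (vle_trans _ _ _ (vle_add2r z _ _ xy)); apply: vle_add2l. Qed.

Lemma vsub_ge0 x y : 0 <=v y - x <-> x <=v y.
Proof.
split=> h; first by have := vle_add2r x _ _ h; rewrite add0r subrK.
by have := vle_add2r (- x) _ _ h; rewrite subrr.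
Qed.

Lemma vle_subl_addr x y z : x - z <=v y <-> x <=v y + z.
Proof. by rewrite -(vsub_ge0 (x - z)) -(vsub_ge0 x) opprB addrA. Qed.

Lemma vle_opp x y : x <=v y -> - y <=v - x.
Proof. by rewrite -(vsub_ge0 x) -(vsub_ge0 (- y)) opprK addrC. Qed.

Lemma vle_scale (a : R) x y : 0 <= a -> x <=v y -> a *: x <=v a *: y.
Proof.
move=> a0; rewrite -(vsub_ge0 x) -(vsub_ge0 (a *: x)) -scalerBr.
exact: vscaler_ge0.
Qed.

Lemma vjoinC x y : vjoin x y = vjoin y x.
Proof. by apply: vle_anti; apply: vjoin_le; (exact: vle_joinl || exact: vle_joinr). Qed.

Lemma vmeetC x y : vmeet x y = vmeet y x.
Proof. by apply: vle_anti; apply: vle_meet; (exact: vmeet_lel || exact: vmeet_ler). Qed.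

Lemma vjoin_r x y : x <=v y -> vjoin x y = y.
Proof.
by move=> xy; apply: vle_anti; [apply: vjoin_le => //; exact: vle_refl|exact: vle_joinr].
Qed.

Lemma vmeet_l x y : x <=v y -> vmeet x y = x.
Proof.
by move=> xy; apply: vle_anti; [exact: vmeet_lel|apply: vle_meet => //; exact: vle_refl].
Qed.

Lemma vmeet_r x y : y <=v x -> vmeet x y = y.
Proof. by move=> yx; rewrite vmeetC vmeet_l. Qed.

Lemma vjoinA x y z : vjoin x (vjoin y z) = vjoin (vjoin x y) z.
Proof.
apply: vle_anti; do ?[apply: vjoin_le].
- by apply: vle_trans (vle_joinl _ _); exact: vle_joinl.
- by apply: vle_trans (vle_joinl _ _); exact: vle_joinr.
- exact: vle_joinr.
- exact: vle_joinl.
- by apply: vle_trans (vle_joinr _ _); exact: vle_joinl.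
- by apply: vle_trans (vle_joinr _ _); exact: vle_joinr.
Qed.

Lemma vmeetA x y z : vmeet x (vmeet y z) = vmeet (vmeet x y) z.
Proof.
apply: vle_anti; do ?[apply: vle_meet].
- exact: vmeet_lel.
- by apply: vle_trans (vmeet_ler _ _) _; exact: vmeet_lel.
- by apply: vle_trans (vmeet_ler _ _) _; exact: vmeet_ler.
- by apply: vle_trans (vmeet_lel _ _) _; exact: vmeet_lel.
- by apply: vle_trans (vmeet_lel _ _) _; exact: vmeet_ler.
- exact: vmeet_ler.
Qed.

Lemma vjoin_meetK x y : vjoin (vmeet x y) x = x.
Proof. exact: vjoin_r (vmeet_lel _ _). Qed.

Lemma vmeet_joinK x y : vmeet x (vjoin x y) = x.
Proof. exact: vmeet_l (vle_joinl _ _). Qed.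

Lemma vjoin_addr x y z : vjoin x y + z = vjoin (x + z) (y + z).
Proof.
apply: vle_anti; last first.
  by apply: vjoin_le; apply: vle_add2r; [exact: vle_joinl|exact: vle_joinr].
rewrite -[z in X in X <=v _]opprK vle_subl_addr.
by apply: vjoin_le; rewrite -vle_subl_addr opprK; [exact: vle_joinl|exact: vle_joinr].
Qed.

Lemma vscale_join (a : R) x y : 0 <= a -> a *: vjoin x y = vjoin (a *: x) (a *: y).
Proof.
rewrite le_eqVlt => /orP[/eqP<-|a0].
  by rewrite !scale0r vjoin_r//; exact: vle_refl.
apply: vle_anti; last first.
  by apply: vjoin_le; apply: vle_scale (ltW a0) _; [exact: vle_joinl|exact: vle_joinr].
rewrite -[X in _ <=v X](scalerKV (lt0r_neq0 a0)).
apply: vle_scale (ltW a0) _.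
have ai : 0 <= a^-1 by rewrite invr_ge0 ltW.
by apply: vjoin_le; rewrite -[X in X <=v _](scalerK (lt0r_neq0 a0)); apply: (vle_scale ai);
  [exact: vle_joinl|exact: vle_joinr].
Qed.

Lemma vle_modulus x : x <=v modulus x. Proof. exact: vle_joinl. Qed.

Lemma modulusN x : modulus (- x) = modulus x.
Proof. by rewrite /modulus opprK vjoinC. Qed.

Lemma modulusB x y : modulus (x - y) = modulus (y - x).
Proof. by rewrite -modulusN opprB. Qed.

(** Twice the modulus dominates [x + (- x) = 0]; halving gives the claim. *)
Lemma modulus_ge0 x : 0 <=v modulus x.
Proof.
have : 0 <=v modulus x + modulus x.
  by rewrite -[0](subrr x); apply: vle_add; [exact: vle_joinl|exact: vle_joinr].
have h2 : (0 : R) <= 2^-1 by rewrite invr_ge0.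
move=> /(vscaler_ge0 _ _ h2).
by rewrite -mulr2n -(scaler_nat 2 (modulus x)) scalerA mulVf ?scale1r// pnatr_eq0.
Qed.

Lemma modulus_id x : 0 <=v x -> modulus x = x.
Proof.
move=> x0; rewrite /modulus vjoinC vjoin_r//.
by apply: vle_trans (x0); rewrite -[X in _ <=v X]oppr0; exact: vle_opp.
Qed.

Lemma modulus_le x y : x <=v y -> - x <=v y -> modulus x <=v y.
Proof. exact: vjoin_le. Qed.

Lemma vle_addB_modulus x y : x <=v y + modulus (x - y).
Proof.
by rewrite -[X in X <=v _](subrKC y); apply: vle_add2l; exact: vle_modulus.
Qed.

(** Birkhoff's inequality: [u] and [z] both lie below [vjoin v z + modulus (u - v)], and exchanging
    [u] and [v] bounds the opposite difference. *)
Lemma modulus_joinB x y z :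
  modulus (vjoin x z - vjoin y z) <=v modulus (x - y).
Proof.
have aux u v : vjoin u z - vjoin v z <=v modulus (u - v).
  rewrite vle_subl_addr addrC; apply: vjoin_le.
    apply: vle_trans (vle_addB_modulus u v) _.
    by apply: vle_add2r; exact: vle_joinl.
  rewrite -[X in X <=v _]addr0.
  by apply: vle_add; [exact: vle_joinr|exact: modulus_ge0].
by apply: modulus_le; [|rewrite opprB modulusB]; exact: aux.
Qed.

Lemma modulus_meetB x y z :
  modulus (vmeet x z - vmeet y z) <=v modulus (x - y).
Proof.
have aux u v : vmeet u z - vmeet v z <=v modulus (u - v).
  suff h : vmeet u z - modulus (u - v) <=v vmeet v z.
    by rewrite vle_subl_addr addrC -vle_subl_addr.
  apply: vle_meet; rewrite vle_subl_addr.
    by apply: vle_trans (vmeet_lel _ _) _; exact: vle_addB_modulus.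
  apply: vle_trans (vmeet_ler _ _) _; rewrite -[X in X <=v _]addr0.
  by apply: vle_add2l; exact: modulus_ge0.
by apply: modulus_le; [|rewrite opprB modulusB]; exact: aux.
Qed.

End VectorLatticeTheory.

(** * Consequences of linearity for bare functions *)

Section LinearProp.
Variables (R : realType) (E F : lmodType R) (f : E -> F).
Hypothesis fL : linear f.

Lemma linear_propD x y : f (x + y) = f x + f y.
Proof. by have := fL 1 x y; rewrite !scale1r. Qed.

Lemma linear_prop0 : f 0 = 0.
Proof. by apply: (addrI (f 0)); rewrite -linear_propD !addr0. Qed.

Lemma linear_propZ (a : R) x : f (a *: x) = a *: f x.
Proof. by have := fL a x 0; rewrite linear_prop0 !addr0. Qed.

Lemma linear_propB x y : f (x - y) = f x - f y.
Proof. by rewrite -scaleN1r linear_propD linear_propZ scaleN1r. Qed.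

End LinearProp.

(** * Order properties of lattice homomorphisms *)

Section LatticeHomomorphism.
Variables (R : realType) (E F : vectorLatticeType R) (f : E -> F).
Hypothesis fH : lattice_homomorphism f.

Lemma lattice_homomorphism_ge0 x : 0 <=v x -> 0 <=v f x.
Proof.
case: fH => fL fJ _ x0.
by rewrite -(vjoin_r x0) fJ (linear_prop0 fL); exact: vle_joinl.
Qed.

Lemma lattice_homomorphism_le x y : x <=v y -> f x <=v f y.
Proof.
case: (fH) => fL _ _; rewrite -vsub_ge0 => /lattice_homomorphism_ge0.
by rewrite linear_propB// vsub_ge0.
Qed.

End LatticeHomomorphism.

(** * Normed lattices *)

Section NormedLatticeTheory.
Variables (R : realType) (E : normedLatticeType R).
Implicit Types x y z : E.

Lemma norm_modulus_le x y : modulus x <=v y -> `|x| <= `|y|.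
Proof.
move=> xy; apply: lattice_norm; rewrite (modulus_id (x := y))//.
exact: vle_trans (modulus_ge0 x) xy.
Qed.

Lemma vle_norm x y : 0 <=v x -> x <=v y -> `|x| <= `|y|.
Proof. by move=> x0 xy; apply: norm_modulus_le; rewrite modulus_id. Qed.

Lemma norm_joinB x y z w :
  `|vjoin x y - vjoin z w| <= `|x - z| + `|y - w|.
Proof.
rewrite -(subrKA (vjoin z y)) (le_trans (ler_normD _ _))// lerD//.
  by apply: lattice_norm; exact: modulus_joinB.
by rewrite !(vjoinC z); apply: lattice_norm; exact: modulus_joinB.
Qed.

Lemma norm_meetB x y z w :
  `|vmeet x y - vmeet z w| <= `|x - z| + `|y - w|.
Proof.
rewrite -(subrKA (vmeet z y)) (le_trans (ler_normD _ _))// lerD//.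
  by apply: lattice_norm; exact: modulus_meetB.
by rewrite !(vmeetC z); apply: lattice_norm; exact: modulus_meetB.
Qed.

Lemma norm_meetBl x y z : `|vmeet x z - vmeet y z| <= `|x - y|.
Proof. by apply: (le_trans (norm_meetB _ _ _ _)); rewrite subrr normr0 addr0. Qed.

Lemma norm_joinBl x y z : `|vjoin x z - vjoin y z| <= `|x - y|.
Proof. by apply: (le_trans (norm_joinB _ _ _ _)); rewrite subrr normr0 addr0. Qed.

Lemma norm_le_eps_eq0 x : (forall e : R, 0 < e -> `|x| <= e) -> x = 0.
Proof.
move=> h; apply/normr0_eq0/eqP; rewrite eq_le normr_ge0 andbT.
by apply/ler_addgt0Pl => e e0; rewrite addr0 h.
Qed.

(** The positive cone is norm closed, because [vmeet _ 0] is nonexpansive and vanishes exactly on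
    it. *)
Lemma vge0_approx x :
  (forall e : R, 0 < e -> exists2 y, 0 <=v y & `|x - y| <= e) -> 0 <=v x.
Proof.
move=> h; suff /eqP : vmeet x 0 - 0 = 0.
  by rewrite subr_eq0 => /eqP <-; exact: vmeet_lel.
apply: norm_le_eps_eq0 => e /h[y y0 xy]; apply: le_trans xy.
by rewrite -{2}(vmeet_r y0) norm_meetBl.
Qed.

Lemma vle_approx x y :
  (forall e : R, 0 < e -> exists z t, [/\ z <=v t, `|x - z| <= e & `|y - t| <= e]) ->
  x <=v y.
Proof.
move=> h; apply/vsub_ge0/vge0_approx => e e0.
have [|z [t [zt xz yt]]] := h (e / 2); first by rewrite divr_gt0.
exists (t - z); first exact/vsub_ge0.
have -> : y - x - (t - z) = (y - t) - (x - z).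
  by rewrite !opprB addrACA [RHS]addrACA [- x - t]addrC.
apply: (le_trans (ler_normB _ _)); lra.
Qed.

Lemma closure_normP (A : set E) x :
  closure A x <-> forall e : R, 0 < e -> exists2 y, A y & `|x - y| < e.
Proof.
split=> [Ax e e0|h B /nbhs_ballP[e /= e0 eB]].
  have [y [Ay xy]] := Ax _ (nbhsx_ballx x e e0).
  by exists y => //; move: xy; rewrite -ball_normE.
have [y Ay xy] := h e e0; exists y; split=> //; apply: eB.
by rewrite -ball_normE.
Qed.

End NormedLatticeTheory.

Section Contractive.
Variables (R : realType) (E F : normedModType R) (f : E -> F).

Lemma contractiveP : linear f -> contractive f <-> forall x, `|f x| <= `|x|.
Proof.
move=> fL; split=> [fc x|fc].
  have [->|x0] := eqVneq x 0; first by rewrite linear_prop0// !normr0.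
  have nx : 0 < `|x| by rewrite normr_gt0.
  have : (`|f (`|x|^-1 *: x)|%:E <= operator_norm f)%E.
    apply: ereal_sup_ubound => /=; exists (`|x|^-1 *: x) => //=.
    by rewrite normrZ normfV normr_id mulVf ?gt_eqF.
  move=> /le_trans/(_ fc); rewrite lee_fin linear_propZ// normrZ normfV normr_id.
  by rewrite mulrC ler_pdivrMr// mul1r.
apply: ge_ereal_sup => _ [x /= x1 <-]; rewrite lee_fin.
exact: le_trans (fc x) x1.
Qed.

End Contractive.

(** * Morphisms in epsilon form *)

Section Morphism.
Variables (R : realType) (E F : banachLatticeType R) (f : E -> F).

(** Of almost interval preservation only the density of the image of [[0, x]] in [[0, f x]] has to
    be kept: the other inclusion follows from monotonicity and the closedness of order intervals,
    and positivity from preservation of joins. *)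
Lemma BL_AIPLH_morphismP :
  BL_AIPLH_morphism f <->
  [/\ lattice_homomorphism f, forall x, `|f x| <= `|x| &
      forall x y (e : R), 0 <=v x -> 0 <=v y -> y <=v f x -> 0 < e ->
      exists z, [/\ 0 <=v z, z <=v x & `|y - f z| < e]].
Proof.
split=> [[fc fH [fL fpos faip]]|[fH fc faip]].
  split=> //; first exact/contractiveP.
  move=> x y e x0 y0 yfx e0.
  have : closure (f @` order_interval 0 x) y by rewrite -faip.
  move=> /closure_normP/(_ e e0)[_ [z [z0 zx] <-] yz].
  by exists z.
have [fL _ _] := fH; split=> //; first exact/contractiveP.
split=> // [|x x0]; first exact: lattice_homomorphism_ge0.
apply/seteqP; split=> y.
  move=> [y0 yfx]; apply/closure_normP => e e0.
  have [z [z0 zx yz]] := faip x y e x0 y0 yfx e0.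
  by exists (f z) => //; exists z.
move=> /closure_normP h; split.
  apply: vge0_approx => e /h[_ [z [z0 _] <-] /ltW yz].
  by exists (f z) => //; exact: lattice_homomorphism_ge0.
apply: vle_approx => e /[dup] e0 /h[_ [z [_ zx] <-] /ltW yz].
exists (f z), (f x); split=> //; first exact: lattice_homomorphism_le.
by rewrite subrr normr0 ltW.
Qed.

End Morphism.

(** * The normed lattice of a lattice seminorm *)

Record lattice_seminorm (R : realType) (V : vectorLatticeType R) :=
  LatticeSeminorm {
    lsn :> V -> R ;
    lsnD : forall x y, lsn (x + y) <= lsn x + lsn y ;
    lsnZ : forall (a : R) x, lsn (a *: x) = `|a| * lsn x ;
    lsn_modulus : forall x y, modulus x <=v modulus y -> lsn x <= lsn y
  }.

Section SeminormQuotient.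
Variables (R : realType) (V : vectorLatticeType R) (p : lattice_seminorm V).
Implicit Types x y z : V.

Lemma lsn0 : p 0 = 0.
Proof. by rewrite -(scale0r 0) lsnZ normr0 mul0r. Qed.

Lemma lsnN x : p (- x) = p x.
Proof. by rewrite -scaleN1r lsnZ normrN normr1 mul1r. Qed.

Lemma lsnB x y : p (x - y) = p (y - x).
Proof. by rewrite -lsnN opprB. Qed.

Lemma lsn_ge0 x : 0 <= p x.
Proof.
have := lsnD p x (- x); rewrite subrr lsn0 lsnN -mulr2n.
by rewrite pmulrn_lge0.
Qed.

Lemma lsn_eq0_trans y x z : p (x - y) = 0 -> p (y - z) = 0 -> p (x - z) = 0.
Proof.
move=> xy yz; apply/eqP; rewrite eq_le lsn_ge0 andbT.
by have := lsnD p (x - y) (y - z); rewrite subrKA xy yz addr0.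
Qed.

Lemma lsn_eq0_le x y : p x <= p y -> p y = 0 -> p x = 0.
Proof. by move=> xy y0; apply/eqP; rewrite eq_le lsn_ge0 andbT -y0. Qed.

(** Canonical representative modulo null vectors: equivalent vectors define the same set, from which
    [xget] picks the same element. The quotient is then the type of vectors fixed by this choice. *)
Definition seminorm_repr x : V := xget 0 [set y | p (y - x) = 0].

Lemma seminorm_reprP x : p (seminorm_repr x - x) = 0.
Proof. by rewrite /seminorm_repr; case: xgetP => // /(_ x)/=; rewrite subrr lsn0. Qed.

Lemma seminorm_repr_eq x y :
  seminorm_repr x = seminorm_repr y <-> p (x - y) = 0.
Proof.
split=> [xy|xy].
  apply: (@lsn_eq0_trans (seminorm_repr x)); first by rewrite lsnB seminorm_reprP.
  by rewrite xy seminorm_reprP.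
rewrite /seminorm_repr; congr xget; apply/seteqP; split=> z /= h.
  exact: lsn_eq0_trans h xy.
by apply: lsn_eq0_trans h _; rewrite lsnB.
Qed.

Record seminorm_quot := SeminormQuot {
  squot_val : V ;
  squot_valP : seminorm_repr squot_val = squot_val
}.

Lemma squot_val_inj : injective squot_val.
Proof.
by move=> [x hx] [y hy] /= xy; subst y; congr SeminormQuot; exact: Prop_irrelevance.
Qed.

Lemma seminorm_repr_idem x : seminorm_repr (seminorm_repr x) = seminorm_repr x.
Proof. exact/seminorm_repr_eq/seminorm_reprP. Qed.

Definition squot x : seminorm_quot := SeminormQuot (seminorm_repr_idem x).

Lemma squot_eq x y : squot x = squot y <-> p (x - y) = 0.
Proof.
rewrite -seminorm_repr_eq; split=> [[]//|xy]; exact: squot_val_inj.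
Qed.

Lemma squot_valK q : squot (squot_val q) = q.
Proof. by apply: squot_val_inj => /=; exact: squot_valP. Qed.

Lemma squotW (P : seminorm_quot -> Prop) : (forall x, P (squot x)) -> forall q, P q.
Proof. by move=> h q; rewrite -(squot_valK q). Qed.

Lemma squot_val_squot x : p (squot_val (squot x) - x) = 0.
Proof. exact: seminorm_reprP. Qed.

Definition squot_map2 (op : V -> V -> V) (q r : seminorm_quot) : seminorm_quot :=
  squot (op (squot_val q) (squot_val r)).

Lemma squot_map2E (op : V -> V -> V) :
  (forall x y z, p (op x z - op y z) <= p (x - y)) ->
  (forall x y z, p (op z x - op z y) <= p (x - y)) ->
  forall x y, squot_map2 op (squot x) (squot y) = squot (op x y).
Proof.
move=> opl opr x y; apply/squot_eq.
apply: (@lsn_eq0_trans (op x (squot_val (squot y)))).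
  exact: lsn_eq0_le (opl _ _ _) (squot_val_squot x).
exact: lsn_eq0_le (opr _ _ _) (squot_val_squot y).
Qed.

Definition squot_add := squot_map2 +%R.
Definition squot_join := squot_map2 (@vjoin R V).
Definition squot_meet := squot_map2 (@vmeet R V).
Definition squot_scale (a : R) (q : seminorm_quot) := squot (a *: squot_val q).

Lemma squot_addE x y : squot_add (squot x) (squot y) = squot (x + y).
Proof.
apply: squot_map2E => {}x {}y z; first by rewrite opprD addrACA subrr addr0.
by rewrite opprD addrACA subrr add0r.
Qed.

Lemma squot_joinE x y : squot_join (squot x) (squot y) = squot (vjoin x y).
Proof.
apply: squot_map2E => {}x {}y z; last rewrite !(vjoinC z);
  by apply: lsn_modulus; exact: modulus_joinB.
Qed.

Lemma squot_meetE x y : squot_meet (squot x) (squot y) = squot (vmeet x y).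
Proof.
apply: squot_map2E => {}x {}y z; last rewrite !(vmeetC z);
  by apply: lsn_modulus; exact: modulus_meetB.
Qed.

Lemma squot_scaleE a x : squot_scale a (squot x) = squot (a *: x).
Proof. by apply/squot_eq; rewrite -scalerBr lsnZ squot_val_squot mulr0. Qed.

HB.instance Definition _ := gen_eqMixin seminorm_quot.
HB.instance Definition _ := gen_choiceMixin seminorm_quot.

Fact squot_addA : associative squot_add.
Proof.
by elim/squotW=> x; elim/squotW=> y; elim/squotW=> z; rewrite !squot_addE addrA.
Qed.
Fact squot_addC : commutative squot_add.
Proof. by elim/squotW=> x; elim/squotW=> y; rewrite !squot_addE addrC. Qed.
Fact squot_add0 : left_id (squot 0) squot_add.
Proof. by elim/squotW=> x; rewrite !squot_addE add0r. Qed.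
Fact squot_addN : left_inverse (squot 0) (squot_scale (-1)) squot_add.
Proof.
by elim/squotW=> x; rewrite squot_scaleE squot_addE scaleN1r addNr.
Qed.

HB.instance Definition _ := GRing.isZmodule.Build seminorm_quot
  squot_addA squot_addC squot_add0 squot_addN.

Lemma squotD x y : squot (x + y) = squot x + squot y.
Proof. by rewrite -squot_addE. Qed.

Fact squot_scaleA (a b : R) q :
  squot_scale a (squot_scale b q) = squot_scale (a * b) q.
Proof. by elim/squotW: q => x; rewrite !squot_scaleE scalerA. Qed.
Fact squot_scale1 : left_id 1 squot_scale.
Proof. by elim/squotW=> x; rewrite !squot_scaleE scale1r. Qed.
Fact squot_scaleDr : right_distributive squot_scale +%R.
Proof.
by move=> a; elim/squotW=> x; elim/squotW=> y;
  rewrite -squotD !squot_scaleE scalerDr squotD.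
Qed.
Fact squot_scaleDl q : {morph squot_scale^~ q : a b / a + b}.
Proof.
by elim/squotW: q => x a b; rewrite !squot_scaleE scalerDl squotD.
Qed.

HB.instance Definition _ := GRing.Zmodule_isLmodule.Build R seminorm_quot
  squot_scaleA squot_scale1 squot_scaleDr squot_scaleDl.

Lemma squotZ a x : squot (a *: x) = a *: squot x.
Proof. by rewrite -squot_scaleE. Qed.

Lemma squotB x y : squot (x - y) = squot x - squot y.
Proof. by rewrite squotD -scaleN1r squotZ scaleN1r. Qed.

(** Encoding the order by joins turns the order axioms into lattice identities, which pass from [V]
    to the quotient. *)
Definition squot_le (q r : seminorm_quot) : Prop := squot_join q r = r.

Fact squot_le_refl q : squot_le q q.
Proof.
by elim/squotW: q => x; rewrite /squot_le squot_joinE vjoin_r//; exact: vle_refl.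
Qed.
Fact squot_joinC : commutative squot_join.
Proof. by elim/squotW=> x; elim/squotW=> y; rewrite !squot_joinE vjoinC. Qed.
Fact squot_meetC : commutative squot_meet.
Proof. by elim/squotW=> x; elim/squotW=> y; rewrite !squot_meetE vmeetC. Qed.
Fact squot_joinA : associative squot_join.
Proof.
by elim/squotW=> x; elim/squotW=> y; elim/squotW=> z; rewrite !squot_joinE vjoinA.
Qed.
Fact squot_meetA : associative squot_meet.
Proof.
by elim/squotW=> x; elim/squotW=> y; elim/squotW=> z; rewrite !squot_meetE vmeetA.
Qed.
Fact squot_join_meetK q r : squot_join (squot_meet q r) q = q.
Proof.
elim/squotW: q => x; elim/squotW: r => y.
by rewrite squot_meetE squot_joinE vjoin_meetK.
Qed.
Fact squot_meet_joinK q r : squot_meet q (squot_join q r) = q.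
Proof.
elim/squotW: q => x; elim/squotW: r => y.
by rewrite squot_joinE squot_meetE vmeet_joinK.
Qed.
Fact squot_le_anti q r : squot_le q r -> squot_le r q -> q = r.
Proof. by rewrite /squot_le squot_joinC => ->. Qed.
Fact squot_le_trans r q s : squot_le q r -> squot_le r s -> squot_le q s.
Proof. by rewrite /squot_le => qr rs; rewrite -rs squot_joinA qr. Qed.
Fact squot_le_joinl q r : squot_le q (squot_join q r).
Proof.
elim/squotW: q => x; elim/squotW: r => y; rewrite /squot_le !squot_joinE.
by rewrite vjoin_r//; exact: vle_joinl.
Qed.
Fact squot_le_joinr q r : squot_le r (squot_join q r).
Proof. by rewrite squot_joinC; exact: squot_le_joinl. Qed.
Fact squot_join_le q r s : squot_le q s -> squot_le r s -> squot_le (squot_join q r) s.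
Proof. by rewrite /squot_le => qs rs; rewrite -squot_joinA rs. Qed.
Fact squot_meet_lel q r : squot_le (squot_meet q r) q.
Proof. exact: squot_join_meetK. Qed.
Fact squot_meet_ler q r : squot_le (squot_meet q r) r.
Proof. by rewrite squot_meetC; exact: squot_meet_lel. Qed.
Fact squot_le_meetE q r : squot_le q r -> squot_meet q r = q.
Proof. by move=> <-; exact: squot_meet_joinK. Qed.
Fact squot_le_meet q r s : squot_le s q -> squot_le s r -> squot_le s (squot_meet q r).
Proof.
move=> /squot_le_meetE sq /squot_le_meetE sr.
by rewrite /squot_le -{1}sr -{1}sq -squot_meetA squot_meetC squot_join_meetK.
Qed.
Fact squot_le_add2r s q r : squot_le q r -> squot_le (q + s) (r + s).
Proof.
elim/squotW: q => x; elim/squotW: r => y; elim/squotW: s => z.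
by rewrite /squot_le -!squotD !squot_joinE -vjoin_addr !squotD => ->.
Qed.
Fact squot_scale_ge0 (a : R) q : 0 <= a -> squot_le 0 q -> squot_le 0 (a *: q).
Proof.
elim/squotW: q => x a0; rewrite /squot_le -squotZ !squot_joinE => h.
by rewrite -(scaler0 _ a) -vscale_join// !squotZ h.
Qed.

HB.instance Definition _ := Lmodule_isVectorLattice.Build R seminorm_quot
  squot_le_refl squot_le_anti squot_le_trans squot_le_joinl squot_le_joinr
  squot_join_le squot_meet_lel squot_meet_ler squot_le_meet squot_le_add2r
  squot_scale_ge0.

Definition squot_norm (q : seminorm_quot) : R := p (squot_val q).

Lemma lsn_eq x y : p (x - y) = 0 -> p x = p y.
Proof.
move=> xy; apply/eqP; rewrite eq_le; apply/andP; split.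
  by have := lsnD p (x - y) y; rewrite xy add0r subrK.
by have := lsnD p (y - x) x; rewrite lsnB xy add0r subrK.
Qed.

Fact squot_normE x : squot_norm (squot x) = p x.
Proof. exact: lsn_eq (squot_val_squot x). Qed.

Fact squot_normD q r : squot_norm (q + r) <= squot_norm q + squot_norm r.
Proof.
elim/squotW: q => x; elim/squotW: r => y.
by rewrite -squotD !squot_normE lsnD.
Qed.
Fact squot_normZ (a : R) q : squot_norm (a *: q) = `|a| * squot_norm q.
Proof. by elim/squotW: q => x; rewrite -squotZ !squot_normE lsnZ. Qed.
Fact squot_norm_eq0 q : squot_norm q = 0 -> q = 0.
Proof.
by elim/squotW: q => x; rewrite squot_normE => x0; apply/squot_eq; rewrite subr0.
Qed.

HB.instance Definition _ := Lmodule_isNormed.Build R seminorm_quot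
  squot_normD squot_normZ squot_norm_eq0.

Lemma norm_squot x : `|squot x| = p x.
Proof. exact: squot_normE. Qed.

Lemma squot_vjoin x y : squot (vjoin x y) = vjoin (squot x) (squot y).
Proof. by rewrite -squot_joinE. Qed.

Lemma squot_vmeet x y : squot (vmeet x y) = vmeet (squot x) (squot y).
Proof. by rewrite -squot_meetE. Qed.

Fact squot_lattice_norm (q r : seminorm_quot) :
  modulus q <=v modulus r -> `|q| <= `|r|.
Proof.
have mod_squot x : modulus (squot x) = squot (modulus x).
  by rewrite /modulus squot_vjoin -scaleN1r -squotZ scaleN1r.
have norm_mod x : p (modulus x) = p x.
  have mm : modulus (modulus x) = modulus x by apply/modulus_id/modulus_ge0.
  by apply/eqP; rewrite eq_le !lsn_modulus// mm; exact: vle_refl.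
elim/squotW: q => x; elim/squotW: r => y; rewrite !mod_squot !norm_squot => h.
(* The hypothesis only says that [modulus y] and its join with [modulus x] have the same class. The
   join has the seminorm of [y] and dominates [modulus x] in [V] itself. *)
have : squot (vjoin (modulus x) (modulus y)) = squot (modulus y).
  by rewrite squot_vjoin vjoin_r.
move=> /squot_eq/lsn_eq; rewrite norm_mod => <-.
rewrite -norm_mod; apply: lsn_modulus.
rewrite (modulus_id (modulus_ge0 x)) (modulus_id (x := vjoin _ _)).
  exact: vle_joinl.
exact: (vle_trans _ _ _ (modulus_ge0 x) (vle_joinl _ _)).
Qed.

HB.instance Definition _ :=
  NormedModule_VectorLattice_isNormedLattice.Build R seminorm_quot squot_lattice_norm.

End SeminormQuotient.

(** * Sequences with geometric control *)

Section Geometric.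
Variable R : realType.

Lemma half_expr_small (c e : R) : 0 < e -> exists n, c * 2^-1 ^+ n <= e.
Proof.
move=> e0; have h : `|2^-1 : R| < 1 by rewrite ger0_norm; lra.
have /cvgrPdist_le/(_ e e0)[n _ hn] := cvg_geometric c h.
exists n; have := hn n (leqnn n); rewrite /geometric/= sub0r normrN.
exact: le_trans (ler_norm _).
Qed.

Lemma half_expr_gt0 n : 0 < 2^-1 ^+ n :> R.
Proof. by rewrite exprn_gt0. Qed.

Lemma half_exprS n : 2^-1 ^+ n = 2 * 2^-1 ^+ n.+1 :> R.
Proof. by rewrite exprS mulrA divff ?mul1r// pnatr_eq0. Qed.

Lemma half_expr_le m n : (m <= n)%N -> 2^-1 ^+ n <= 2^-1 ^+ m :> R.
Proof. by move=> mn; apply: ler_wiXn2l => //; lra. Qed.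

Lemma complete_geometric (E : completeNormedModType R) (u : nat -> E) (c : R) :
  (forall n m, (n <= m)%N -> `|u n - u m| <= c * 2^-1 ^+ n) ->
  exists l, forall n, `|l - u n| <= c * 2^-1 ^+ n.
Proof.
move=> hu.
have /cauchy_cvg/cvg_ex[l ul] : cauchy (u @ \oo).
  apply: cauchy_exP => e e0.
  have [n hn] := half_expr_small c (divr_gt0 e0 (ltr0n R 2)).
  exists (u n); exists n => // m /= nm; rewrite -ball_normE /=.
  by apply: le_lt_trans (hu _ _ nm) _; apply: le_lt_trans hn _; lra.
exists l => n; apply/ler_addgt0Pl => e e0.
have /cvgrPdist_le/(_ e e0)[k _ hk] := ul.
have := hk (maxn k n) (leq_maxl _ _) => h1.
have := hu n (maxn k n) (leq_maxr _ _); rewrite distrC => h2.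
rewrite -(subrKA (u (maxn k n))); apply: le_trans (ler_normD _ _) _.
exact: lerD.
Qed.

End Geometric.

(** * Direct systems *)

Section Eventually.
Variables (d : Order.disp_t) (I : preorderType d).

Definition ev (P : I -> Prop) : Prop := exists i, forall j, (i <= j)%O -> P j.

Hypothesis hI : directed I.

Lemma ev_and (P Q : I -> Prop) : ev P -> ev Q -> ev (fun i => P i /\ Q i).
Proof.
move=> [i hi] [j hj]; have [k [ik jk]] := hI.2 i j; exists k => l kl.
by split; [apply: hi|apply: hj]; apply: le_trans kl.
Qed.

Lemma ev_mono (P Q : I -> Prop) : (forall i, P i -> Q i) -> ev P -> ev Q.
Proof. by move=> PQ [i hi]; exists i => j /hi/PQ. Qed.

Lemma ev_ex (P : I -> Prop) i : ev P -> exists2 j, (i <= j)%O & P j.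
Proof. by move=> [k hk]; have [l [il /hk]] := hI.2 i k; exists l. Qed.

Lemma ev_all (P : I -> Prop) : (forall i, P i) -> ev P.
Proof. by case: hI => -[i] _ h; exists i. Qed.

End Eventually.

Arguments ds_map {R d I} _ {i j} _ _.

(** * Asymptotically coherent nets *)

Section CoherentNets.
Variables (R : realType) (d : Order.disp_t) (I : preorderType d).
Variable S : direct_system R I.

Lemma ds_mapH i j (ij : (i <= j)%O) : lattice_homomorphism (ds_map S ij).
Proof. by have /BL_AIPLH_morphismP[] := ds_map_morphism S ij. Qed.

Lemma ds_mapL i j (ij : (i <= j)%O) : linear (ds_map S ij).
Proof. by case: (ds_mapH ij). Qed.

Lemma ds_map_norm i j (ij : (i <= j)%O) x : `|ds_map S ij x| <= `|x|.
Proof. by have /BL_AIPLH_morphismP[_ + _] := ds_map_morphism S ij; apply. Qed.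

Lemma ds_mapB i j (ij : (i <= j)%O) x y :
  ds_map S ij (x - y) = ds_map S ij x - ds_map S ij y.
Proof. exact: linear_propB (ds_mapL ij) _ _. Qed.

Lemma ds_map0 i j (ij : (i <= j)%O) : ds_map S ij 0 = 0.
Proof. exact: linear_prop0 (ds_mapL ij). Qed.

Lemma ds_map_normB i j (ij : (i <= j)%O) x y :
  `|ds_map S ij x - ds_map S ij y| <= `|x - y|.
Proof. by rewrite -ds_mapB ds_map_norm. Qed.

Lemma ds_map_map i j k (ij : (i <= j)%O) (jk : (j <= k)%O) (ik : (i <= k)%O) x :
  ds_map S jk (ds_map S ij x) = ds_map S ik x.
Proof. by rewrite -(ds_map_comp S ij jk ik). Qed.

Definition coherent (x : forall i, S i) : Prop :=
  forall e : R, 0 < e -> exists i, forall j k (jk : (j <= k)%O), (i <= j)%O ->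
    `|ds_map S jk (x j) - x k| <= e.

Hypothesis hI : directed I.

(** One argument for addition, scaling, join and meet: the connecting map moves inside [op], and a
    Lipschitz constant uniform in the index controls the two remaining errors. *)
Lemma coherent_map2 (op : forall i, S i -> S i -> S i) (C : R) x y :
  (forall i j (ij : (i <= j)%O) u v,
     ds_map S ij (op i u v) = op j (ds_map S ij u) (ds_map S ij v)) ->
  0 < C ->
  (forall i u v u' v', `|op i u v - op i u' v'| <= C * (`|u - u'| + `|v - v'|)) ->
  coherent x -> coherent y -> coherent (fun i => op i (x i) (y i)).
Proof.
move=> opm C0 opC cx cy e e0.
(* [C] times the sum of two such errors is [e]. *)
have e1 : 0 < e / (2 * C) by rewrite divr_gt0// mulr_gt0.
have [i hi] := cx _ e1; have [j hj] := cy _ e1.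
have [k [ik jk]] := hI.2 i j; exists k => m n mn km.
rewrite opm; apply: le_trans (opC _ _ _ _ _) _.
rewrite -(ler_pdivlMl _ _ C0).
have := hi m n mn (le_trans ik km); have := hj m n mn (le_trans jk km).
have -> : C^-1 * e = e / (2 * C) + e / (2 * C).
  by rewrite [2 * C]mulrC invfM mulrA -splitr mulrC.
by move=> *; rewrite lerD.
Qed.

Record coherent_net := CoherentNet {
  net_val :> forall i, S i ;
  net_coherent : coherent net_val
}.

Lemma net_eq (x y : coherent_net) : (forall i, x i = y i) -> x = y.
Proof.
case: x y => [x hx] [y hy] /= xy.
have {xy} : x = y by exact: functional_extensionality_dep.
move=> xy; subst y.
by congr CoherentNet; exact: Prop_irrelevance.
Qed.

Lemma coherent_constant (i0 : I) (x : forall i, S i) :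
  (forall j k (jk : (j <= k)%O), (i0 <= j)%O -> ds_map S jk (x j) = x k) ->
  coherent x.
Proof. by move=> h e e0; exists i0 => j k jk ij; rewrite h// subrr normr0 ltW. Qed.

Lemma coherent0 : coherent (fun i => 0).
Proof. by case: hI => -[i] _; apply: (@coherent_constant i) => *; exact: ds_map0. Qed.

Lemma coherentD x y : coherent x -> coherent y -> coherent (fun i => x i + y i).
Proof.
apply: (@coherent_map2 (fun i => +%R) 1) => // [i j ij|i] u v.
  exact: linear_propD (ds_mapL ij) _ _.
by move=> u' v'; rewrite mul1r opprD addrACA ler_normD.
Qed.

Lemma coherentZ (a : R) x : coherent x -> coherent (fun i => a *: x i).
Proof.
(* The operation ignores its second argument, and [1 + |a|] stays positive when [a = 0]. *)
move=> cx; apply: (@coherent_map2 (fun i u v => a *: u) (1 + `|a|) x x) => //.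
  by move=> i j ij u v; rewrite (linear_propZ (ds_mapL ij)).
move=> i u v u' v'; rewrite -scalerBr normrZ ler_pM//; first by rewrite lerDr.
by rewrite lerDl.
Qed.

Lemma coherent_join x y :
  coherent x -> coherent y -> coherent (fun i => vjoin (x i) (y i)).
Proof.
apply: (@coherent_map2 (fun i => @vjoin R (S i)) 1) => // [i j ij|i] u v.
  by case: (ds_mapH ij) => _ ->.
by move=> u' v'; rewrite mul1r norm_joinB.
Qed.

Lemma coherent_meet x y :
  coherent x -> coherent y -> coherent (fun i => vmeet (x i) (y i)).
Proof.
apply: (@coherent_map2 (fun i => @vmeet R (S i)) 1) => // [i j ij|i] u v.
  by case: (ds_mapH ij) => _ _ ->.
by move=> u' v'; rewrite mul1r norm_meetB.
Qed.

End CoherentNets.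

(** * The vector lattice of coherent nets and its limsup seminorm *)

Section NetLattice.
Variables (R : realType) (d : Order.disp_t) (I : preorderType d).
Variables (hI : directed I) (S : direct_system R I).

(* The hypothesis [hI] is an argument of the type because already the zero net
   is coherent only over a non-empty index set. *)
Definition dnet & directed I := coherent_net S.
Local Notation N := (dnet hI).
Implicit Types x y z : N.

HB.instance Definition _ := gen_eqMixin N.
HB.instance Definition _ := gen_choiceMixin N.

Definition net0 : N := CoherentNet (coherent0 S hI).
Definition net_add x y : N :=
  CoherentNet (coherentD hI (net_coherent x) (net_coherent y)).
Definition net_scale (a : R) x : N := CoherentNet (coherentZ hI a (net_coherent x)).
Definition net_join x y : N :=
  CoherentNet (coherent_join hI (net_coherent x) (net_coherent y)).
Definition net_meet x y : N :=
  CoherentNet (coherent_meet hI (net_coherent x) (net_coherent y)).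

Fact net_addA : associative net_add.
Proof. by move=> x y z; apply: net_eq => i /=; rewrite addrA. Qed.
Fact net_addC : commutative net_add.
Proof. by move=> x y; apply: net_eq => i /=; rewrite addrC. Qed.
Fact net_add0 : left_id net0 net_add.
Proof. by move=> x; apply: net_eq => i /=; rewrite add0r. Qed.
(** Opposites are multiples by -1, so unfolding a difference of nets shows [-1 *: y i]; later
    rewrites with [scaleN1r] remove it. *)
Fact net_addN : left_inverse net0 (net_scale (-1)) net_add.
Proof. by move=> x; apply: net_eq => i /=; rewrite scaleN1r addNr. Qed.

HB.instance Definition _ := GRing.isZmodule.Build N
  net_addA net_addC net_add0 net_addN.

Fact net_scaleA (a b : R) x : net_scale a (net_scale b x) = net_scale (a * b) x.
Proof. by apply: net_eq => i /=; rewrite scalerA. Qed.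
Fact net_scale1 : left_id 1 net_scale.
Proof. by move=> x; apply: net_eq => i /=; rewrite scale1r. Qed.
Fact net_scaleDr : right_distributive net_scale +%R.
Proof. by move=> a x y; apply: net_eq => i /=; rewrite scalerDr. Qed.
Fact net_scaleDl x : {morph net_scale^~ x : a b / a + b}.
Proof. by move=> a b; apply: net_eq => i /=; rewrite scalerDl. Qed.

HB.instance Definition _ := GRing.Zmodule_isLmodule.Build R N
  net_scaleA net_scale1 net_scaleDr net_scaleDl.

(** The order is taken at every index; forgetting any initial behaviour is left to the quotient by
    the seminorm. *)
Definition net_le x y : Prop := forall i, x i <=v y i.

Fact net_le_refl x : net_le x x.
Proof. by move=> i; exact: vle_refl. Qed.
Fact net_le_anti x y : net_le x y -> net_le y x -> x = y.
Proof. by move=> xy yx; apply: net_eq => i; apply: vle_anti. Qed.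
Fact net_le_trans y x z : net_le x y -> net_le y z -> net_le x z.
Proof. by move=> xy yz i; apply: vle_trans (xy i) (yz i). Qed.
Fact net_le_joinl x y : net_le x (net_join x y).
Proof. by move=> i; exact: vle_joinl. Qed.
Fact net_le_joinr x y : net_le y (net_join x y).
Proof. by move=> i; exact: vle_joinr. Qed.
Fact net_join_le x y z : net_le x z -> net_le y z -> net_le (net_join x y) z.
Proof. by move=> xz yz i; exact: vjoin_le. Qed.
Fact net_meet_lel x y : net_le (net_meet x y) x.
Proof. by move=> i; exact: vmeet_lel. Qed.
Fact net_meet_ler x y : net_le (net_meet x y) y.
Proof. by move=> i; exact: vmeet_ler. Qed.
Fact net_le_meet x y z : net_le z x -> net_le z y -> net_le z (net_meet x y).
Proof. by move=> zx zy i; exact: vle_meet. Qed.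
Fact net_le_add2r z x y : net_le x y -> net_le (x + z) (y + z).
Proof. by move=> xy i; exact: vle_add2r. Qed.
Fact net_scale_ge0 (a : R) x : 0 <= a -> net_le 0 x -> net_le 0 (a *: x).
Proof. by move=> a0 x0 i; exact: vscaler_ge0. Qed.

HB.instance Definition _ := Lmodule_isVectorLattice.Build R N
  net_le_refl net_le_anti net_le_trans net_le_joinl net_le_joinr
  net_join_le net_meet_lel net_meet_ler net_le_meet net_le_add2r
  net_scale_ge0.

Lemma net_bounded x : exists r, ev (fun i => `|x i| <= r).
Proof.
have [i hi] := net_coherent x ltr01.
exists (`|x i| + 1), i => j ij; have := hi i j ij (lexx _) => h.
rewrite -(subrKC (ds_map S ij (x i)) (x j)) (le_trans (ler_normD _ _))// lerD//.
  exact: ds_map_norm.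
by rewrite distrC.
Qed.

Definition limsup_norm x : R := inf [set r | ev (fun i => `|x i| <= r)].

Lemma limsup_norm_has_inf x : has_inf [set r | ev (fun i => `|x i| <= r)].
Proof.
split; first exact: net_bounded.
case: hI => -[i] _; exists 0 => r /= /(ev_ex hI i)[j _]; exact: le_trans.
Qed.

Lemma limsup_norm_le x r : ev (fun i => `|x i| <= r) -> limsup_norm x <= r.
Proof. by move=> h; apply: ge_inf => //; case: (limsup_norm_has_inf x). Qed.

Lemma limsup_norm_ge0 x : 0 <= limsup_norm x.
Proof.
apply: lb_le_inf; first exact: net_bounded.
case: hI => -[i] _ r /= /(ev_ex hI i)[j _]; exact: le_trans.
Qed.

Lemma limsup_norm_lt x r : limsup_norm x < r -> ev (fun i => `|x i| <= r).
Proof.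
rewrite -subr_gt0 => /inf_adherent/(_ (limsup_norm_has_inf x))[s /= hs].
rewrite subrKC => sr; apply: ev_mono hs => i h; exact: le_trans h (ltW sr).
Qed.

Lemma limsup_norm_ev x e : 0 < e -> ev (fun i => `|x i| <= limsup_norm x + e).
Proof. by move=> e0; apply: limsup_norm_lt; rewrite ltrDl. Qed.

Fact limsup_normD x y : limsup_norm (x + y) <= limsup_norm x + limsup_norm y.
Proof.
apply/ler_addgt0Pl => e e0; have e2 : 0 < e / 2 by rewrite divr_gt0.
apply: limsup_norm_le.
have := ev_and hI (limsup_norm_ev x e2) (limsup_norm_ev y e2).
apply: ev_mono => i [hx hy].
rewrite (le_trans (ler_normD _ _))// (le_trans (lerD hx hy))//; lra.
Qed.

Fact limsup_normZ (a : R) x : limsup_norm (a *: x) = `|a| * limsup_norm x.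
Proof.
have le b y : limsup_norm (b *: y) <= `|b| * limsup_norm y.
  apply/ler_addgt0Pl => e e0.
  (* The added 1 keeps the divisor positive when [b = 0]. *)
  have b0 : 0 < `|b| + 1 by rewrite ltr_wpDl.
  apply: limsup_norm_le; have := limsup_norm_ev y (divr_gt0 e0 b0).
  apply: ev_mono => i hy; rewrite normrZ (le_trans (ler_wpM2l (normr_ge0 b) hy))//.
  rewrite mulrDr addrC lerD2r mulrCA ger_pMr// ler_pdivrMr// mul1r.
  by rewrite lerDl.
apply/eqP; rewrite eq_le le/=; have [->|a0] := eqVneq a 0.
  by rewrite normr0 mul0r limsup_norm_ge0.
(* The reverse inequality is [le] for the scalar [a^-1] and the net [a *: x]. *)
rewrite -ler_pdivlMl ?normr_gt0// -normfV.
by rewrite -{1}(scalerK a0 x) le.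
Qed.

Fact limsup_norm_modulus x y :
  modulus x <=v modulus y -> limsup_norm x <= limsup_norm y.
Proof.
move=> xy; apply/ler_addgt0Pl => e e0; rewrite addrC.
apply: limsup_norm_le; apply: ev_mono (limsup_norm_ev y e0) => i.
apply: le_trans; apply: lattice_norm; have := xy i.
by rewrite /modulus /= !scaleN1r.
Qed.

Definition limsup_seminorm : lattice_seminorm N :=
  LatticeSeminorm limsup_normD limsup_normZ limsup_norm_modulus.

End NetLattice.

(** * The direct limit *)

Section DirectLimit.
Variables (R : realType) (d : Order.disp_t) (I : preorderType d).
Variables (hI : directed I) (S : direct_system R I).

(** The default 0 at indices not above [i] respects the linear and lattice operations, and it does
    not affect the class of the net, since the seminorm only sees eventual values. *)
Definition tail_fun i (x : S i) (k : I) : S k :=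
  if pselect (i <= k)%O is left ik then ds_map S ik x else 0.

Lemma tail_funE i (x : S i) k (ik : (i <= k)%O) : tail_fun x k = ds_map S ik x.
Proof.
rewrite /tail_fun; case: pselect => // h.
by rewrite (bool_irrelevance h ik).
Qed.

Fact tail_coherent i (x : S i) : coherent (tail_fun x).
Proof.
apply: (@coherent_constant _ _ _ _ i) => j k jk ij.
by rewrite (tail_funE x ij) (tail_funE x (le_trans ij jk)) (ds_map_map _ _ (le_trans ij jk)).
Qed.

Definition tail i (x : S i) : dnet S hI := CoherentNet (tail_coherent x).

Lemma tail_linear i : linear (@tail i).
Proof.
move=> a x y; apply: net_eq => k; rewrite /= /tail_fun.
by case: pselect => [ik|_]; [exact: ds_mapL|rewrite scaler0 addr0].
Qed.

Lemma tail_join i (x y : S i) : tail (vjoin x y) = vjoin (tail x) (tail y).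
Proof.
apply: net_eq => k; rewrite /= /tail_fun.
case: pselect => [ik|_]; first by case: (ds_mapH S ik) => _ ->.
by rewrite vjoin_r//; exact: vle_refl.
Qed.

Lemma tail_meet i (x y : S i) : tail (vmeet x y) = vmeet (tail x) (tail y).
Proof.
apply: net_eq => k; rewrite /= /tail_fun.
case: pselect => [ik|_]; first by case: (ds_mapH S ik) => _ _ ->.
by rewrite vmeet_l//; exact: vle_refl.
Qed.

Definition dlim : Type := seminorm_quot (limsup_seminorm hI S).
HB.instance Definition _ := NormedLattice.on dlim.

Definition dlim_map i (x : S i) : dlim := squot (limsup_seminorm hI S) (tail x).

(** Together with [norm_dlim_map_lt] this identifies the norm of [dlim_map x] as the limit superior
    of the norms of the images of [x] along the system. *)
Lemma norm_dlim_map_le i (x : S i) r :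
  ev (fun k => forall ik : (i <= k)%O, `|ds_map S ik x| <= r) -> `|dlim_map x| <= r.
Proof.
move=> h; rewrite /dlim_map norm_squot; apply: limsup_norm_le.
have hi : ev (fun k => (i <= k)%O) by exists i.
by apply: ev_mono (ev_and hI h hi) => k [/[swap] ik /(_ ik)]; rewrite /= tail_funE.
Qed.

Lemma norm_dlim_map_lt i (x : S i) r : `|dlim_map x| < r ->
  ev (fun k => forall ik : (i <= k)%O, `|ds_map S ik x| <= r).
Proof.
rewrite norm_squot => /limsup_norm_lt; apply: ev_mono => k h ik.
by rewrite -tail_funE.
Qed.

Lemma dlim_mapH i : lattice_homomorphism (@dlim_map i).
Proof.
split.
- by move=> a x y; rewrite /dlim_map tail_linear squotD squotZ.
- by move=> x y; rewrite /dlim_map tail_join squot_vjoin.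
- by move=> x y; rewrite /dlim_map tail_meet squot_vmeet.
Qed.

Lemma dlim_mapB i (x y : S i) : dlim_map (x - y) = dlim_map x - dlim_map y.
Proof. by case: (dlim_mapH i) => /linear_propB h _ _; exact: h. Qed.

Lemma norm_dlim_map i (x : S i) : `|dlim_map x| <= `|x|.
Proof. by apply: norm_dlim_map_le; exists i => k _ ik; exact: ds_map_norm. Qed.

Lemma dlim_map_compat i j (ij : (i <= j)%O) x : dlim_map (ds_map S ij x) = dlim_map x.
Proof.
apply/eqP; rewrite -subr_eq0 -squotB -normr_eq0 norm_squot eq_le.
rewrite limsup_norm_ge0 andbT; apply: limsup_norm_le; exists j => k jk /=.
rewrite (tail_funE _ jk) (tail_funE _ (le_trans ij jk)) (ds_map_map _ _ (le_trans ij jk)).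
by rewrite scaleN1r subrr normr0.
Qed.

(** Far enough out, the component [x j] of a representing net approximates its class: by coherence
    its images stay close to the later components. *)
Lemma dlim_dense (q : dlim) e : 0 < e ->
  ev (fun i => exists x : S i, `|q - dlim_map x| < e).
Proof.
move=> e0; elim/squotW: q => x; have e2 : 0 < e / 2 by rewrite divr_gt0.
have [i hi] := net_coherent x e2; exists i => j ij; exists (x j).
rewrite -squotB norm_squot; apply: (@le_lt_trans _ _ (e / 2)); last by lra.
apply: limsup_norm_le; exists j => k jk /=.
by rewrite (tail_funE _ jk) scaleN1r distrC; exact: hi.
Qed.

(** * Limits of geometrically controlled sequences of representatives *)

Section Completeness.
Variables (i_ : nat -> I) (y : forall n, S (i_ n)).
Hypothesis i_S : forall n, (i_ n <= i_ n.+1)%O.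
Hypothesis y_S : forall n j (h : (i_ n <= j)%O) (h' : (i_ n.+1 <= j)%O),
  `|ds_map S h (y n) - ds_map S h' (y n.+1)| <= 2 * 2^-1 ^+ n.

Lemma index_mono n m : (n <= m)%N -> (i_ n <= i_ m)%O.
Proof.
elim: m => [|m IHm]; first by rewrite leqn0 => /eqP->.
by rewrite leq_eqVlt ltnS => /predU1P[->//|/IHm] /le_trans; apply.
Qed.

Lemma geometric_telescope n m j (h : (i_ n <= j)%O) (h' : (i_ m <= j)%O) :
  (n <= m)%N -> `|ds_map S h (y n) - ds_map S h' (y m)| <= 4 * 2^-1 ^+ n.
Proof.
(* The sharper bound is the exact sum of the steps [2 * 2^-k] for k from [n] to [m - 1], which makes
   the induction close. *)
move=> nm; suff: `|ds_map S h (y n) - ds_map S h' (y m)|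
    <= 4 * (2^-1 ^+ n - 2^-1 ^+ m).
  by have := half_expr_gt0 R m; lra.
elim: m nm h' => [|m IHm] nm h'.
  move: nm; rewrite leqn0 => /eqP n0; subst n.
  by rewrite (bool_irrelevance h h') !subrr normr0 mulr0.
move: nm; rewrite leq_eqVlt ltnS => /predU1P[nm|nm].
  by subst n; rewrite (bool_irrelevance h h') !subrr normr0 mulr0.
have hm : (i_ m <= j)%O by exact: le_trans (i_S m) h'.
rewrite -(subrKA (ds_map S hm (y m))); apply: le_trans (ler_normD _ _) _.
have := IHm nm hm; have := y_S hm h'; rewrite (half_exprS R m); lra.
Qed.

(** The [n] with [i_ n <= j] form an initial segment. If it is everything, take the limit of the
    images in the complete space [S j]; otherwise take the image at the last such [n]. *)
Lemma geometric_limit j :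
  exists x : S j, forall n (h : (i_ n <= j)%O), `|x - ds_map S h (y n)| <= 4 * 2^-1 ^+ n.
Proof.
have [hj|] := pselect (forall n, (i_ n <= j)%O).
  have [|x hx] := @complete_geometric _ (S j) (fun n => ds_map S (hj n) (y n)) 4.
    by move=> n m nm; exact: geometric_telescope.
  by exists x => n h; rewrite (bool_irrelevance h (hj n)).
move=> /existsNP[k /negP hk].
have exk : exists k, ~~ (i_ k <= j)%O by exists k.
case: (ex_minnP exk) => -[|m] hm mmin.
  (* No [i_ n] lies below [j], so the condition is void and 0 serves. *)
  exists 0 => n h; case/negP: hm; exact: le_trans (index_mono (leq0n n)) h.
have hmj : (i_ m <= j)%O.
  by apply/negPn/negP => /mmin; rewrite ltnn.
exists (ds_map S hmj (y m)) => n h; rewrite distrC; apply: geometric_telescope.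
rewrite leqNgt; apply/negP => mn; case/negP: hm.
exact: le_trans (index_mono mn) h.
Qed.

Lemma geometric_dlim : exists q : dlim, forall n, `|q - dlim_map (y n)| <= 4 * 2^-1 ^+ n.
Proof.
pose x j := sval (cid (geometric_limit j)).
have hx j := svalP (cid (geometric_limit j)) : forall n h, `|x j - _| <= _.
have cx : coherent x.
  (* Two comparisons with the image of [y n], each costing [4 * 2^-n], add up to the 8. *)
  move=> e e0; have [n hn] := half_expr_small 8 e0.
  exists (i_ n) => j k jk ij; apply: le_trans hn.
  have ik := le_trans ij jk.
  rewrite -(subrKA (ds_map S ik (y n))); apply: le_trans (ler_normD _ _) _.
  have -> : (8 : R) = 4 + 4 by lra.
  rewrite mulrDl lerD//; last by rewrite distrC.
  apply: le_trans (hx j n ij); apply: le_trans (ds_map_normB jk _ _).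
  by rewrite (ds_map_map _ _ ik).
pose X : dnet S hI := CoherentNet cx.
exists (squot (limsup_seminorm hI S) X) => n; rewrite -squotB norm_squot.
apply: limsup_norm_le; exists (i_ n) => k ik /=.
by rewrite (tail_funE _ ik) scaleN1r.
Qed.

End Completeness.

Lemma norm_dlim_map_lt_ub i j (x : S i) (y : S j) r :
  `|dlim_map x - dlim_map y| < r ->
  ev (fun k => forall (ik : (i <= k)%O) (jk : (j <= k)%O),
    `|ds_map S ik x - ds_map S jk y| <= r).
Proof.
move=> xyr; have [l [il jl]] := hI.2 i j.
move: xyr; rewrite -(dlim_map_compat il) -(dlim_map_compat jl) -dlim_mapB.
move=> /norm_dlim_map_lt h.
have hl : ev (fun k => (l <= k)%O) by exists l.
apply: ev_mono (ev_and hI h hl) => k [/[swap] lk /(_ lk)] + ik jk.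
by rewrite ds_mapB !(ds_map_map _ _ ik) !(ds_map_map _ _ jk).
Qed.

Fact dlim_complete (F : set_system dlim) : ProperFilter F -> cauchy F -> cvg F.
Proof.
move=> FF /cauchyP Fc.
pose r n : R := 2^-1 ^+ n.
(* [A n a] says that the image of [a] in the limit is the centre of a ball of radius [2^-n]
   belonging to [F]; by density such [a] exist above every index. *)
pose A n (a : {i & S i}) := F (ball (dlim_map (projT2 a)) (r n)).
have A_ex n i : exists2 a, A n a & (i <= projT1 a)%O.
  have r2 : 0 < r n / 2 by rewrite divr_gt0// half_expr_gt0.
  have [q Fq] := Fc _ r2.
  have [j ij [x qx]] := ev_ex hI i (dlim_dense q r2).
  exists (existT _ j x) => //=; apply: filterS Fq => t.
  rewrite -ball_normE /= => qt.
  rewrite -(subrKA q); apply: le_lt_trans (ler_normD _ _) _.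
  by rewrite [X in _ < X]splitr; apply: ltrD; [rewrite distrC; exact: qx|exact: qt].
pose T := {na : nat * {i & S i} | A na.1 na.2}.
pose step (a b : T) := [/\ (sval b).1 = (sval a).1.+1,
  (projT1 (sval a).2 <= projT1 (sval b).2)%O &
  forall j (h : (projT1 (sval a).2 <= j)%O) (h' : (projT1 (sval b).2 <= j)%O),
    `|ds_map S h (projT2 (sval a).2) - ds_map S h' (projT2 (sval b).2)|
      <= 2 * r (sval a).1].
have step_ex a : {b | step a b}.
  apply: cid; case: a => -[n [i x]] /= Aa.
  have [[j y] Ab ij] := A_ex n.+1 i.
  (* Both balls belong to [F], hence meet, so the centres differ by less than [r n + r n.+1], which
     is at most [2 * r n]. *)
  have : `|dlim_map x - dlim_map y| < 2 * r n.
    have [t []] := filter_ex (filterI Aa Ab); rewrite -!ball_normE /= => xt yt.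
    rewrite -(subrKA t); apply: le_lt_trans (ler_normD _ _) _.
    rewrite mulr_natl mulr2n; apply: ltrD; first exact: xt.
    by rewrite distrC; exact: lt_le_trans yt (half_expr_le R (leqnSn n)).
  (* The norm in the limit is only a limit superior. Moving [y] up to a late [k] makes the bound
     hold in [S k], and contractivity carries it to every later [l]. *)
  move=> /norm_dlim_map_lt_ub/(ev_ex hI j)[k jk hk].
  have Ak : A n.+1 (existT _ k (ds_map S jk y)).
    by rewrite /A /= dlim_map_compat.
  exists (exist _ (n.+1, existT _ k (ds_map S jk y)) Ak); split => //=.
    exact: le_trans ij jk.
  move=> l il kl; rewrite (ds_map_map _ _ (le_trans jk kl)).
  have := hk (le_trans ij jk) jk; apply: le_trans.
  apply: le_trans (ds_map_normB kl _ _).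
  by rewrite !(ds_map_map _ _ il) !(ds_map_map _ _ (le_trans jk kl)).
have [i0] := hI.1; have [a0 Aa0 _] := A_ex 0%N i0.
have [f [f0 fS]] := dependent_choice step_ex (exist _ (0%N, a0) Aa0).
have fn n : (sval (f n)).1 = n.
  by elim: n => [|n IHn]; [rewrite f0|case: (fS n) => -> _ _; rewrite IHn].
have [||q hq] := @geometric_dlim (fun n => projT1 (sval (f n)).2)
    (fun n => projT2 (sval (f n)).2).
- by move=> n; case: (fS n).
- by move=> n j h h'; case: (fS n) => _ _ /(_ j h h'); rewrite fn.
apply/cvg_ex; exists q => B /nbhs_ballP[e /= e0 eB].
(* The point [q] is within [4 * r n] of the centre and the ball adds [r n], so 6 covers the
   total. *)
have [n hn] := half_expr_small 6 e0.
have : F (ball (dlim_map (projT2 (sval (f n)).2)) (r n)).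
  by have := svalP (f n); rewrite /A fn.
apply: filterS => t ht; apply: eB; move: ht; rewrite -!ball_normE /= => ht.
rewrite -(subrKA (dlim_map (projT2 (sval (f n)).2))).
apply: le_lt_trans (ler_normD _ _) _.
apply: lt_le_trans (ler_ltD (hq n) ht) _; apply: le_trans hn.
rewrite /r; have := half_expr_gt0 R n; lra.
Qed.

HB.instance Definition _ := Uniform_isComplete.Build dlim dlim_complete.

End DirectLimit.

(** * Dense images and norm domination imply the universal property *)

Section UniversalProperty.
Variables (R : realType) (d : Order.disp_t) (I : preorderType d).
Variables (hI : directed I) (S : direct_system R I).
Variables (E : banachLatticeType R) (phi : forall i, S i -> E).
Hypothesis phiH : forall i, lattice_homomorphism (@phi i).
Hypothesis phi_norm : forall i (x : S i), `|phi x| <= `|x|.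
Hypothesis phi_compat : forall i j (ij : (i <= j)%O) x, phi (ds_map S ij x) = phi x.
Hypothesis phi_norm_lt : forall i (x : S i) r, `|phi x| < r ->
  ev (fun k => forall ik : (i <= k)%O, `|ds_map S ik x| <= r).
Hypothesis phi_dense : forall (q : E) (e : R), 0 < e ->
  ev (fun i => exists x : S i, `|q - phi x| < e).

(** For almost interval preservation, [y] is approximated at a stage [j] above [i] by density, and
    the connecting map leads back to [S i]. *)
Lemma dense_compatible : compatible_system phi.
Proof.
split=> [i|i j ij]; last by apply/funext => x; exact: phi_compat.
apply/BL_AIPLH_morphismP; split=> // x y e x0 y0 yx e0.
have e2 : 0 < e / 2 by rewrite divr_gt0.
have [j ij [w yw]] := ev_ex hI i (phi_dense y e2).
have [phiL phiJ phiM] := phiH j.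
(* Clamping [w] into the interval below the image of [x] does not increase its distance to [y],
   because [y] lies in [[0, phi x]]. *)
pose w' := vmeet (vjoin w 0) (ds_map S ij x).
have yw' : `|y - phi w'| < e / 2.
  apply: le_lt_trans yw; rewrite phiM phiJ linear_prop0// phi_compat.
  rewrite -{1}(vmeet_l yx); apply: le_trans (norm_meetBl _ _ _) _.
  rewrite -{1}(vjoin_r y0) vjoinC; exact: norm_joinBl.
have w0 : 0 <=v w'.
  by apply: vle_meet; [exact: vle_joinr|exact: lattice_homomorphism_ge0 (ds_mapH _ _) _ _].
have /BL_AIPLH_morphismP[_ _ aip] := ds_map_morphism S ij.
have [z [z0 zx wz]] := aip x w' _ x0 w0 (vmeet_ler _ _) e2.
exists z; split=> //; rewrite -(phi_compat ij) -(subrKA (phi w')).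
apply: le_lt_trans (ler_normD _ _) _; rewrite [e]splitr; apply: ltrD => //.
by rewrite -(linear_propB phiL); exact: le_lt_trans (phi_norm _) wz.
Qed.

(** * Factorization of a compatible system *)

Section Comparison.
Variables (E' : banachLatticeType R) (phi' : forall i, S i -> E').
Hypothesis phi'C : compatible_system phi'.

Lemma compatible_map i j (ij : (i <= j)%O) x : phi' (ds_map S ij x) = phi' x.
Proof. by rewrite -(phi'C.2 i j ij). Qed.

Lemma compatibleH i : lattice_homomorphism (@phi' i).
Proof. by have /BL_AIPLH_morphismP[] := phi'C.1 i. Qed.

(** [phi' x] is also the [phi'] image of each later transport of [x], whose norm is eventually at
    most [|phi x| + e]. *)
Lemma compatible_norm i (x : S i) : `|phi' x| <= `|phi x|.
Proof.
apply/ler_addgt0Pl => e e0.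
have : `|phi x| < e + `|phi x| by rewrite ltrDr.
move=> /phi_norm_lt/(ev_ex hI i)[k ik /(_ ik)]; apply: le_trans.
rewrite -(compatible_map ik).
by have /BL_AIPLH_morphismP[_ + _] := phi'C.1 k; apply.
Qed.

Lemma compatible_normB i j (x : S i) (y : S j) : `|phi' x - phi' y| <= `|phi x - phi y|.
Proof.
have [k [ik jk]] := hI.2 i j.
rewrite -(compatible_map ik) -(compatible_map jk) -(phi_compat ik) -(phi_compat jk).
have [phiL _ _] := phiH k; have [phi'L _ _] := compatibleH k.
by rewrite -(linear_propB phiL) -(linear_propB phi'L); exact: compatible_norm.
Qed.

(** This is the extension by continuity of [phi x |-> phi' x], described by distances so that the
    value at [q] does not depend on an approximating sequence. *)
Definition factor_value (q : E) (v : E') : Prop :=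
  forall i (x : S i), `|v - phi' x| <= `|q - phi x|.

Lemma factor_value_ex q : exists v, factor_value q v.
Proof.
have /choice[a ha] (n : nat) : exists a : {i & S i}, `|q - phi (projT2 a)| < 2^-1 ^+ n.
  have [i hi] := phi_dense q (half_expr_gt0 R n).
  by have [x qx] := hi i (lexx i); exists (existT _ i x).
have [n m nm|v hv] := @complete_geometric R E' (fun n => phi' (projT2 (a n))) 2.
  apply: le_trans (compatible_normB _ _) _.
  rewrite -(subrKA q); apply: le_trans (ler_normD _ _) _.
  rewrite mulr_natl mulr2n; apply: lerD; first by rewrite distrC; exact/ltW/ha.
  exact: le_trans (ltW (ha m)) (half_expr_le _ nm).
exists v => i x; apply/ler_addgt0Pl => e e0.
(* The distance from [v] to the n-th term costs [2 * 2^-n], and replacing [q] by its n-th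
   approximation another [2^-n]. *)
have [n hn] := half_expr_small 3 e0.
rewrite -(subrKA (phi' (projT2 (a n)))).
apply: le_trans (ler_normD _ _) _.
have h1 := hv n; have h2 := compatible_normB (projT2 (a n)) x.
have h3 : `|phi (projT2 (a n)) - phi x| <= 2^-1 ^+ n + `|q - phi x|.
  rewrite -(subrKA q); apply: le_trans (ler_normD _ _) _.
  by apply: lerD => //; rewrite distrC; exact/ltW/ha.
apply: le_trans (lerD h1 (le_trans h2 h3)) _; rewrite addrA lerD2r; lra.
Qed.

Lemma factor_value_uniq q v w : factor_value q v -> factor_value q w -> v = w.
Proof.
move=> hv hw; apply/eqP; rewrite -subr_eq0; apply/eqP/norm_le_eps_eq0 => e e0.
have [i /(_ i (lexx i))[x qx]] := phi_dense q (divr_gt0 e0 (ltr0n R 2)).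
rewrite -(subrKA (phi' x)); apply: le_trans (ler_normD _ _) _.
rewrite [e]splitr; apply: lerD; last rewrite distrC.
  exact: le_trans (hv _ _) (ltW qx).
exact: le_trans (hw _ _) (ltW qx).
Qed.

Definition factor (q : E) : E' := sval (cid (factor_value_ex q)).

Lemma factorP q : factor_value q (factor q).
Proof. exact: svalP (cid (factor_value_ex q)). Qed.

Lemma factor_phi i (x : S i) : factor (phi x) = phi' x.
Proof.
apply/eqP; rewrite -subr_eq0 -normr_le0; apply: le_trans (factorP _ _) _.
by rewrite subrr normr0.
Qed.

(** Both operations are Lipschitz and agree on the dense images, so the identity extends by
    approximating [q] and [r] at a common stage. *)
Lemma factor_map2 (op : E -> E -> E) (op' : E' -> E' -> E')
    (ops : forall i, S i -> S i -> S i) (C : R) : 0 < C ->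
  (forall q r s t, `|op q r - op s t| <= C * (`|q - s| + `|r - t|)) ->
  (forall q r s t, `|op' q r - op' s t| <= C * (`|q - s| + `|r - t|)) ->
  (forall i (x y : S i), phi (ops i x y) = op (phi x) (phi y)) ->
  (forall i (x y : S i), phi' (ops i x y) = op' (phi' x) (phi' y)) ->
  forall q r, factor (op q r) = op' (factor q) (factor r).
Proof.
move=> C0 opC op'C phi_op phi'_op q r.
apply/eqP; rewrite -subr_eq0; apply/eqP/norm_le_eps_eq0 => e e0.
have e1 : 0 < e / (4 * C) by rewrite divr_gt0// mulr_gt0.
have [i /(_ i (lexx i))[[x qx] [y ry]]] :=
  ev_and hI (phi_dense q e1) (phi_dense r e1).
rewrite -(subrKA (phi' (ops i x y))); apply: le_trans (ler_normD _ _) _.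
have bound : C * (e / (4 * C) + e / (4 * C)) = e / 2.
  by field; rewrite gt_eqF.
rewrite [e]splitr; apply: lerD.
  apply: le_trans (factorP _ _) _; rewrite phi_op.
  apply: le_trans (opC _ _ _ _) _; rewrite -bound ler_pM2l//.
  by apply: lerD; exact: ltW.
rewrite distrC phi'_op; apply: le_trans (op'C _ _ _ _) _.
rewrite -bound ler_pM2l//; apply: lerD; apply: le_trans (factorP _ _) _; exact: ltW.
Qed.

Lemma factorH : lattice_homomorphism factor.
Proof.
have lip (F : normedModType R) (a : R) (q r s t : F) :
    `|a *: q + r - (a *: s + t)| <= (1 + `|a|) * (`|q - s| + `|r - t|).
  rewrite opprD addrACA -scalerBr; apply: le_trans (ler_normD _ _) _.
  rewrite normrZ mulrDr; apply: lerD; first by rewrite ler_wpM2r// lerDr.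
  by rewrite ler_peMl// lerDl.
split.
- move=> a; apply: (@factor_map2 (fun q r => a *: q + r) (fun q r => a *: q + r)
    (fun i x y => a *: x + y) (1 + `|a|)) => //.
  + exact: lip.
  + exact: lip.
  + by move=> i x y; case: (phiH i) => ->.
  + by move=> i x y; case: (compatibleH i) => ->.
- apply: (@factor_map2 (@vjoin R E) (@vjoin R E') (fun i => @vjoin R (S i)) 1) => //.
  + by move=> *; rewrite mul1r norm_joinB.
  + by move=> *; rewrite mul1r norm_joinB.
  + by move=> i x y; case: (phiH i) => _ ->.
  + by move=> i x y; case: (compatibleH i) => _ ->.
- apply: (@factor_map2 (@vmeet R E) (@vmeet R E') (fun i => @vmeet R (S i)) 1) => //.
  + by move=> *; rewrite mul1r norm_meetB.
  + by move=> *; rewrite mul1r norm_meetB.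
  + by move=> i x y; case: (phiH i) => _ _ ->.
  + by move=> i x y; case: (compatibleH i) => _ _ ->.
Qed.

Lemma factor_norm q : `|factor q| <= `|q|.
Proof.
case: hI => -[i] _; have := @factorP q i 0.
have [phiL _ _] := phiH i; have [phi'L _ _] := compatibleH i.
by rewrite (linear_prop0 phiL) (linear_prop0 phi'L) !subr0.
Qed.

Lemma factor_morphism : BL_AIPLH_morphism factor.
Proof.
apply/BL_AIPLH_morphismP; split; [exact: factorH|exact: factor_norm|].
have [factorL factorJ factorM] := factorH.
move=> q y e q0 y0 yq e0; have e4 : 0 < e / 4 by rewrite divr_gt0.
have [i /(_ i (lexx i))[x qx]] := phi_dense q e4.
have [phiL phiJ phiM] := phiH i.
(* [q] is replaced by the image of a positive [x'] at stage [i], and then [y] is cut down to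
   [[0, phi' x']], where [phi'] is almost interval preserving. *)
pose x' := vjoin x 0.
have x'0 : 0 <=v x' by exact: vle_joinr.
have qx' : `|q - phi x'| < e / 4.
  apply: le_lt_trans qx; rewrite phiJ linear_prop0//.
  rewrite -{1}(vjoin_r q0) vjoinC; exact: norm_joinBl.
pose y' := vmeet y (phi' x').
have y'0 : 0 <=v y'.
  by apply: vle_meet => //; exact: lattice_homomorphism_ge0 (compatibleH i) _ x'0.
have yy' : `|y - y'| < e / 4.
  apply: le_lt_trans qx'; apply: le_trans (factorP _ _).
  by rewrite -{1}(vmeet_l yq) /y' ![vmeet y _]vmeetC; exact: norm_meetBl.
have /BL_AIPLH_morphismP[_ _ aip] := phi'C.1 i.
have [z [z0 zx y'z]] := aip x' y' _ x'0 y'0 (vmeet_ler _ _) e4.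
(* [phi z] lies below [phi x'] but perhaps not below [q]; cutting it with [q] moves it by at most
   the distance from [q] to [phi x']. *)
pose w := vmeet (phi z) q.
have zw : `|phi z - w| < e / 4.
  apply: le_lt_trans qx'.
  have zx' : phi z <=v phi x' by exact: lattice_homomorphism_le.
  rewrite -{1}(vmeet_l zx') /w ![vmeet (phi z) _]vmeetC distrC.
  exact: norm_meetBl.
exists w; split; [|exact: vmeet_ler|].
  by apply: vle_meet => //; exact: lattice_homomorphism_ge0.
have h : `|phi' z - factor w| < e / 4.
  rewrite -factor_phi -linear_propB//.
  exact: le_lt_trans (factor_norm _) zw.
rewrite -(subrKA y') -[y' - factor w](subrKA (phi' z)) addrA.
apply: le_lt_trans (ler_normD _ _) _.
apply: le_lt_trans (lerD (ler_normD _ _) (lexx _)) _; lra.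
Qed.

End Comparison.

Lemma dense_direct_limit : direct_limit phi.
Proof.
split; first exact: dense_compatible.
move=> E' phi' phi'C; exists (factor phi'C); split.
  split; first exact: factor_morphism.
  by move=> i; apply/funext => x /=; rewrite factor_phi.
move=> chi [/BL_AIPLH_morphismP[[chiL _ _] chi_norm _] chiE].
apply/funext => q; apply: (@factor_value_uniq E' phi' q).
  exact: factorP.
(* Linearity and contractivity make [chi q] a factor value at [q]. *)
move=> i x; rewrite chiE /= -linear_propB//; exact: chi_norm.
Qed.

End UniversalProperty.

(** * Order continuity *)

Section Gaps.
Variables (R : realType) (E : normedLatticeType R) (x : nat -> E).

(** The sequence may have no infimum, while order continuity speaks of nets decreasing to 0. The
    differences between a term and a lower bound form such a net. *)
Record gap := Gap {
  gap_index : nat ;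
  gap_bound : E ;
  gap_boundP : forall n, gap_bound <=v x n
}.

Definition gap_size (g : gap) : E := x (gap_index g) - gap_bound g.

(** Later gaps are the smaller ones; different gaps may have equal size, so this is only a
    preorder. *)
Definition gap_le (g h : gap) : bool := `[< gap_size h <=v gap_size g >].

Fact gap_le_refl : reflexive gap_le.
Proof. by move=> g; apply/asboolP; exact: vle_refl. Qed.
Fact gap_le_trans : transitive gap_le.
Proof. by move=> h g k /asboolP gh /asboolP hk; apply/asboolP; exact: vle_trans hk gh. Qed.

HB.instance Definition _ := gen_eqMixin gap.
HB.instance Definition _ := gen_choiceMixin gap.
HB.instance Definition _ :=
  Order.Le_isPreorder.Build (Order.Disp tt tt) gap gap_le_refl gap_le_trans.

Hypothesis x_decr : forall n, x n.+1 <=v x n.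
Hypothesis x_ge0 : forall n, 0 <=v x n.

Lemma antitone_step_le n m : (n <= m)%N -> x m <=v x n.
Proof.
elim: m => [|m IHm]; first by rewrite leqn0 => /eqP->; exact: vle_refl.
rewrite leq_eqVlt ltnS => /predU1P[->|/IHm]; first exact: vle_refl.
exact: vle_trans (x_decr m).
Qed.

Lemma gap_directed : directed gap.
Proof.
split; first by constructor; exact: (@Gap 0 0 x_ge0).
move=> [n y hy] [m z hz].
have hyz k : vjoin y z <=v x k by exact: vjoin_le.
exists (@Gap (maxn n m) _ hyz); split; apply/asboolP; apply: vle_add.
- exact/antitone_step_le/leq_maxl.
- exact/vle_opp/vle_joinl.
- exact/antitone_step_le/leq_maxr.
- exact/vle_opp/vle_joinr.
Qed.

(* If w is below all gaps then adding w to a lower bound of the sequence gives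
   a lower bound again, so n w <= x 0 for all n, and w <= 0. *)
Lemma gap_infimum : is_infimum (range gap_size) 0.
Proof.
split=> [_ [[n y hy] _ <-]|w hw]; first exact/vsub_ge0.
have step y : (forall n, y <=v x n) -> forall n, y + w <=v x n.
  move=> hy n; have hg := hw _ (ex_intro2 _ _ (@Gap n y hy) I erefl).
  by have := vle_add2r y _ _ hg; rewrite /gap_size /= subrK addrC.
have wn k n : w *+ k <=v x n.
  by elim: k n => [//|k IHk] n; rewrite mulrSr; apply: step.
apply: vle_approx => e e0.
pose k := (Num.truncn (`|x 0%N| / e)).+1.
have k0 : 0 < k%:R :> R by rewrite ltr0n.
exists w, (k%:R^-1 *: x 0%N); split.
- have ki : 0 <= k%:R^-1 :> R by rewrite invr_ge0 ltW.
  have := vle_scale ki (wn k 0%N).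
  by rewrite -(scaler_nat k w) scalerA mulVf ?scale1r// gt_eqF.
- by rewrite subrr normr0 ltW.
- rewrite sub0r normrN normrZ ger0_norm ?invr_ge0 ?ler0n//.
  rewrite ler_pdivrMl// -ler_pdivrMr//.
  exact/ltW/truncnS_gt.
Qed.

(** A gap of norm below [e], with index [N] and bound [y], suffices, as [0 <= x N - x n <= x N - y]
    for [n >= N]. *)
Lemma order_continuous_decreasing : order_continuous E ->
  forall e : R, 0 < e -> exists N, forall n, (N <= n)%N -> `|x N - x n| < e.
Proof.
move=> oc e e0.
have gap_decr (g h : gap) : (g <= h)%O -> gap_size h <=v gap_size g.
  by move=> /asboolP.
have [[N y hy] hN] := oc _ gap gap_size gap_directed gap_decr gap_infimum e e0.
exists N => n Nn; apply: le_lt_trans (hN _ (lexx _)).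
apply: vle_norm; first exact/vsub_ge0/antitone_step_le.
by apply: vle_add2l; exact: vle_opp.
Qed.

End Gaps.

(** * Order continuity passes through dense images *)

Section OrderContinuity.
Variables (R : realType) (d : Order.disp_t) (I : preorderType d).
Variable S : direct_system R I.
Variables (E : banachLatticeType R) (phi : forall i, S i -> E).
Hypothesis phi_morphism : forall i, BL_AIPLH_morphism (@phi i).
Hypothesis phi_dense :
  forall (q : E) (e : R), 0 < e -> exists i (x : S i), `|q - phi x| < e.
Hypothesis S_oc : forall i, order_continuous (S i).

(* A decreasing sequence below phi v is the image, up to e, of a decreasing
   sequence in [0, v]: take partial meets of almost interval preserving
   preimages. *)
Lemma dominated_decreasing i (v : S i) (x : nat -> E) :
  0 <=v v -> (forall n, x n.+1 <=v x n) -> (forall n, 0 <=v x n) ->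
  (forall n, x n <=v phi v) ->
  forall e : R, 0 < e -> exists N, forall n, (N <= n)%N -> `|x N - x n| < e.
Proof.
move=> v0 x_decr x0 xv e e0.
have /BL_AIPLH_morphismP[[phiL _ phiM] phi_norm aip] := phi_morphism i.
pose c := e / 6; have c0 : 0 < c by rewrite divr_gt0.
have /choice[w hw] (n : nat) : exists w : S i,
    0 <=v w /\ `|x n - phi w| <= c * 2^-1 ^+ n.+1.
  have [|w [w0 _ /ltW xw]] := aip v (x n) (c * 2^-1 ^+ n.+1) v0 (x0 n) (xv n).
    by rewrite mulr_gt0// half_expr_gt0.
  by exists w.
pose y := fix y n := if n is m.+1 then vmeet (y m) (w m.+1) else w 0%N.
have y_decr n : y n.+1 <=v y n by exact: vmeet_lel.
have y0 n : 0 <=v y n.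
  by elim: n => [|n IHn] /=; [case: (hw 0%N)|apply: vle_meet => //; case: (hw n.+1)].
(* Since [x n.+1] is its own meet with [x n], each meet adds only the error of the new [w]; the
   bound is the sum of [c * 2^-(k+1)] for k up to [n]. *)
have xy n : `|x n - phi (y n)| <= c * (1 - 2^-1 ^+ n.+1).
  elim: n => [|n IHn] /=.
    by have [_] := hw 0%N; rewrite expr1; lra.
  rewrite phiM -{1}(vmeet_r (x_decr n)); apply: le_trans (norm_meetB _ _ _ _) _.
  apply: le_trans (lerD IHn (hw n.+1).2) _.
  by rewrite -mulrDr ler_pM2l// (half_exprS R n.+1); lra.
have {}xy n : `|x n - phi (y n)| <= c.
  by apply: le_trans (xy n) _; rewrite ger_pMr// gerBl.
have [N hN] := order_continuous_decreasing y_decr y0 (@S_oc i) c0.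
exists N => n Nn.
have h1 := xy N; have h2 := xy n; rewrite distrC in h2.
have h3 : `|phi (y N) - phi (y n)| <= c.
  by rewrite -linear_propB//; exact: le_trans (phi_norm _) (ltW (hN n Nn)).
rewrite -(subrKA (phi (y N))); apply: le_lt_trans (ler_normD _ _) _.
rewrite -(subrKA (phi (y n)) (phi (y N))).
apply: le_lt_trans (lerD h1 (le_trans (ler_normD _ _) (lerD h3 h2))) _.
rewrite /c; lra.
Qed.

(** All terms lie below [x 0], so truncating them at some [phi v] close to [x 0] moves each by at
    most the distance from [x 0] to [phi v]; the truncated sequence is dominated. *)
Lemma decreasing_cauchy (x : nat -> E) :
  (forall n, x n.+1 <=v x n) -> (forall n, 0 <=v x n) ->
  forall e : R, 0 < e -> exists N, forall n, (N <= n)%N -> `|x N - x n| < e.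
Proof.
move=> x_decr x0 e e0; have e4 : 0 < e / 4 by rewrite divr_gt0.
have [i [u xu]] := phi_dense (x 0%N) e4.
have /BL_AIPLH_morphismP[[phiL phiJ _] _ _] := phi_morphism i.
pose v := vjoin u 0; pose z n := vmeet (x n) (phi v).
have xv : `|x 0%N - phi v| <= e / 4.
  apply: le_trans (ltW xu); rewrite phiJ linear_prop0//.
  rewrite -{1}(vjoin_r (x0 0%N)) vjoinC; exact: norm_joinBl.
have v0 : 0 <=v v by exact: vle_joinr.
have pv0 : 0 <=v phi v.
  by have /BL_AIPLH_morphismP[h _ _] := phi_morphism i; exact: lattice_homomorphism_ge0.
have z_decr n : z n.+1 <=v z n.
  apply: vle_meet; last exact: vmeet_ler.
  exact: vle_trans (vmeet_lel _ _) (x_decr n).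
have z0 n : 0 <=v z n by exact: vle_meet.
have [N hN] := dominated_decreasing v0 z_decr z0 (fun n => vmeet_ler _ _) e4.
have xz n : `|x n - z n| <= e / 4.
  apply: le_trans xv; rewrite -{1}(vmeet_l (antitone_step_le x_decr (leq0n n))).
  by rewrite /z ![vmeet (x n) _]vmeetC; exact: norm_meetBl.
exists N => n Nn; have h1 := xz N; have h2 := xz n; rewrite distrC in h2.
rewrite -(subrKA (z N)); apply: le_lt_trans (ler_normD _ _) _.
rewrite -(subrKA (z n) (z N)).
apply: le_lt_trans (lerD h1 (le_trans (ler_normD _ _) (lerD (ltW (hN n Nn)) h2))) _.
lra.
Qed.

(** The net is Cauchy, hence converges by completeness; its limit is a positive lower bound, and the
    infimum 0 forces it to vanish. *)
Lemma dense_order_continuous : order_continuous E.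
Proof.
move=> d' J x hJ x_decr [x_lb x_inf].
have x0 j : 0 <=v x j by apply: x_lb; exists j.
have x_cauchy e : 0 < e -> exists j, forall k, (j <= k)%O -> `|x j - x k| < e.
  move=> e0; apply: contrapT => /forallNP hx.
  (* If the Cauchy condition fails for [e], dependent choice extracts a decreasing sequence whose
     consecutive terms are at least [e] apart. *)
  have step j : {k | (j <= k)%O /\ e <= `|x j - x k|}.
    apply: cid; have /existsNP[k /not_implyP[jk /negP]] := hx j.
    by rewrite -leNgt => ek; exists k.
  have [j0] := hJ.1; have [f [_ fS]] := dependent_choice step j0.
  have [N /(_ N.+1 (leqnSn N))] := decreasing_cauchy
    (fun n => x_decr _ _ (fS n).1) (fun n => x0 (f n)) e0.
  by rewrite ltNge (fS N).2.
pose F : set_system E := [set A | ev (fun j => A (x j))].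
have FF : ProperFilter F.
  apply: Build_ProperFilter.
    by move=> [j /(_ j (lexx j))].
  apply: Build_Filter; first exact: ev_all.
    by move=> A B; exact: ev_and.
  by move=> A B AB; apply: ev_mono => j; exact: AB.
have /cauchy_cvg/cvg_ex[l xl] : cauchy F.
  apply: cauchy_exP => e /x_cauchy[j hj]; exists (x j); exists j => k jk.
  by rewrite -ball_normE; exact: hj.
have {}xl e : 0 < e -> ev (fun j => `|l - x j| < e).
  move=> e0; have [j hj] := xl _ (nbhsx_ballx l e e0).
  by exists j => k /hj; rewrite -ball_normE.
have l0 : l = 0.
  apply: vle_anti.
    apply: x_inf => _ [j _ <-]; apply: vle_approx => e e0.
    have [k jk lk] := ev_ex hJ j (xl e e0).
    exists (x k), (x j); split; [exact: x_decr|exact: ltW|].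
    by rewrite subrr normr0 ltW.
  apply: vge0_approx => e e0; have [j0] := hJ.1.
  by have [k _ lk] := ev_ex hJ j0 (xl e e0); exists (x k); last exact: ltW.
move=> e e0; have [j hj] := xl e e0; exists j => k /hj.
by rewrite l0 sub0r normrN.
Qed.

End OrderContinuity.

(** * Identities, composites and transfer between direct limits *)

Lemma BL_AIPLH_morphism_id (R : realType) (E : banachLatticeType R) :
  BL_AIPLH_morphism (@id E).
Proof.
apply/BL_AIPLH_morphismP; split=> // x y e _ y0 yx e0.
by exists y; rewrite subrr normr0.
Qed.

Lemma BL_AIPLH_morphism_comp (R : realType) (E F G : banachLatticeType R)
    (g : F -> G) (f : E -> F) :
  BL_AIPLH_morphism g -> BL_AIPLH_morphism f -> BL_AIPLH_morphism (g \o f).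
Proof.
move=> /BL_AIPLH_morphismP[gH g_norm g_aip] /BL_AIPLH_morphismP[fH f_norm f_aip].
have [[gL gJ gM] [fL fJ fM]] := (gH, fH).
apply/BL_AIPLH_morphismP; split.
- split=> [a x y|x y|x y] /=; first by rewrite fL gL.
    by rewrite fJ gJ.
  by rewrite fM gM.
- by move=> x; exact: le_trans (g_norm _) (f_norm _).
- move=> x y e x0 y0 yx e0; have e2 : 0 < e / 2 by rewrite divr_gt0.
  have fx0 := lattice_homomorphism_ge0 fH x0.
  have [w [w0 wx yw]] := g_aip _ y _ fx0 y0 yx e2.
  have [z [z0 zx wz]] := f_aip x w _ x0 w0 wx e2.
  exists z; split=> //=; rewrite -(subrKA (g w)).
  apply: le_lt_trans (ler_normD _ _) _; rewrite [e]splitr; apply: ltrD => //.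
  by rewrite -linear_propB//; exact: le_lt_trans (g_norm _) wz.
Qed.

(* Any direct limit is isomorphic to the given one, so density of the images
   transfers to it. *)
Lemma direct_limit_dense (R : realType) (d : Order.disp_t) (I : preorderType d)
    (S : direct_system R I) (E F : banachLatticeType R)
    (phi : forall i, S i -> E) (psi : forall i, S i -> F) :
  direct_limit phi -> direct_limit psi ->
  (forall (q : E) (e : R), 0 < e -> exists i (x : S i), `|q - phi i x| < e) ->
  forall (q : F) (e : R), 0 < e -> exists i (x : S i), `|q - psi i x| < e.
Proof.
move=> [phiC phiU] [psiC psiU] phi_dense q e e0.
have [f [[fM fE] _]] := phiU F psi psiC.
have [g [[gM gE] _]] := psiU E phi phiC.
have [h [_ h_uniq]] := psiU F psi psiC.
have fgK : f \o g = id.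
  rewrite -(h_uniq (f \o g)) ?(h_uniq id)//.
    by split=> //; exact: BL_AIPLH_morphism_id.
  split=> [|i]; first exact: BL_AIPLH_morphism_comp.
  by rewrite -compA -gE -fE.
have [i [x qx]] := phi_dense (g q) e e0; exists i, x.
have /BL_AIPLH_morphismP[[fL _ _] f_norm _] := fM.
have {1}<- : f (g q) = q by rewrite -[RHS]/(id q) -fgK.
by rewrite fE /= -linear_propB//; exact: le_lt_trans (f_norm _) qx.
Qed.

Theorem theorem6p4 (R : realType) (d : Order.disp_t) (I : preorderType d)
    (hI : directed I) (S : direct_system R I) :
  (exists (E : banachLatticeType R) (phi : forall i : I, S i -> E),
     direct_limit phi) /\
  (forall (E : banachLatticeType R) (phi : forall i : I, S i -> E),
     direct_limit phi ->
     (forall i : I, order_continuous (S i)) ->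
     order_continuous E).
Proof.
have lim : direct_limit (fun i => @dlim_map R d I hI S i).
  apply: (dense_direct_limit hI).
  - exact: dlim_mapH.
  - exact: norm_dlim_map.
  - exact: dlim_map_compat.
  - exact: norm_dlim_map_lt.
  - exact: dlim_dense.
split; first by eexists; eexists; exact: lim.
move=> E phi limE S_oc; apply: (@dense_order_continuous R d I S E phi) => //.
  exact: limE.1.1.
apply: direct_limit_dense lim limE _ => q e e0.
have [i /(_ i (lexx i))[x qx]] := dlim_dense q e0.
by exists i, x.
Qed.
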